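(* Let $1<p<\infty$. There is a constant $C$ depending only on $n$ and $p$ such that for every weight $w\in A_p$ on $\mathbb{R}^n$ and all $a,b\in BMO^{\mathcal{D}}(\mathbb{R}^n)$, $$\|\Pi_a^*\Pi_b:L^p(w)\to L^p(w)\|\le C\,\|a\|_{BMO^{\mathcal{D}}}\|b\|_{BMO^{\mathcal{D}}}\,[w]_{A_p}^{\max\left(1,\frac1{p-1}\right)}.$$
   Context: $\mathcal{D}$ is a fixed dyadic grid on $\mathbb{R}^n$: a collection of cubes with side lengths $2^k$, $k\in\mathbb{Z}$, such that for each fixed $k$ the cubes of side length $2^k$ partition $\mathbb{R}^n$, and $P\cap Q\in\{P,Q,\emptyset\}$ for all $P,Q\in\mathcal{D}$. Haar functions: for an interval $I$, $h_I^0=|I|^{-1/2}(\mathbf{1}_{I_+}-\mathbf{1}_{I_-})$ ($I_\pm$ the right/left halves) and $h_I^1=|I|^{-1/2}\mathbf{1}_I$; for $Q=I_1\times\dots\times I_n\in\mathcal{D}$ and $\epsilon\in\{0,1\}^n$, $h_Q^\epsilon(x)=\prod_kh_{I_k}^{\epsilon_k}(x_k)$, cancellative when $\epsilon\not\equiv1$. A weight is a locally integrable, a.e. positive function; $\langle f\rangle_Q=\frac1{|Q|}\int_Qf\,dx$, $(f,g)=\int fg\,dx$; $L^p(w)$ is $L^p$ of the measure $w\,dx$. With $1/p+1/p'=1$, $w'=w^{1-p'}$, $w\in A_p$ means $[w]_{A_p}:=\sup_Q\langle w\rangle_Q\langle w'\rangle_Q^{p-1}<\infty$ over cubes $Q\subset\mathbb{R}^n$.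 $\|b\|_{BMO^{\mathcal{D}}}=\sup_{Q\in\mathcal{D}}\frac1{|Q|}\int_Q|b-\langle b\rangle_Q|\,dx$. $\Pi_a^*\Pi_bf=\sum_{Q\in\mathcal{D}}\sum_{\epsilon\not\equiv1}(a,h_Q^\epsilon)(b,h_Q^\epsilon)\langle f\rangle_Q\frac{\mathbf{1}_Q}{|Q|}$, the composition of the paraproducts $\Pi_bf=\sum_{Q,\epsilon\not\equiv1}(b,h_Q^\epsilon)\langle f\rangle_Qh_Q^\epsilon$ and $\Pi_a^*f=\sum_{Q,\epsilon\not\equiv1}(a,h_Q^\epsilon)(f,h_Q^\epsilon)\frac{\mathbf{1}_Q}{|Q|}$. $\|T:X\to Y\|$ is the operator norm. *)

(* Defs.v *)
From HB Require Import structures.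
From mathcomp Require Import all_boot all_order all_algebra.
From mathcomp Require Import all_classical all_reals all_analysis.
From mathcomp Require Import measurable_realfun.

Set Implicit Arguments.
Unset Strict Implicit.
Unset Printing Implicit Defensive.
Import Order.TTheory GRing.Theory Num.Theory.
Import numFieldNormedType.Exports.

Local Open Scope classical_set_scope.
Local Open Scope ring_scope.

(* R^n with its product (Borel) sigma-algebra. *)
Notation Rn R n := (n.-tuple (measurableTypeR R)).

Section lebesgue_tuple.
Context {R : realType}.

Section cons_measure.
Variables (n : nat) (mu : {sigma_finite_measure set (Rn R n) -> \bar R}).

Definition cons_pair (z : measurableTypeR R * Rn R n) : Rn R n.+1 :=
  [tuple of z.1 :: z.2].

Lemma measurable_cons_pair : measurable_fun setT cons_pair.
Proof. exact: measurable_cons. Qed.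

Definition cons_measure (A : set (Rn R n.+1)) : \bar R :=
  (lebesgue_measure \x mu)%E (cons_pair @^-1` A).

Let measurable_preimage_cons (A : set (Rn R n.+1)) :
  measurable A -> measurable (cons_pair @^-1` A).
Proof.
by move=> mA; rewrite -[X in measurable X]setTI; apply: measurable_cons_pair.
Qed.

Let cons_measure0 : cons_measure set0 = 0%E.
Proof. by rewrite /cons_measure preimage_set0 measure0. Qed.

Let cons_measure_ge0 A : (0 <= cons_measure A)%E.
Proof. exact: measure_ge0. Qed.

Let cons_measure_sigma_additive : semi_sigma_additive cons_measure.
Proof.
move=> F mF tF mUF; rewrite /cons_measure preimage_bigcup.
apply: measure_semi_sigma_additive.
- by move=> i; exact: measurable_preimage_cons.
- apply/trivIsetP => /= i j _ _ ij; rewrite -preimage_setI.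
  by move/trivIsetP : tF => /(_ _ _ _ _ ij) ->//; rewrite preimage_set0.
- by rewrite -preimage_bigcup; exact: measurable_preimage_cons.
Qed.

HB.instance Definition _ := isMeasure.Build _ _ _
  cons_measure cons_measure0 cons_measure_ge0 cons_measure_sigma_additive.

Let uncons (t : Rn R n.+1) : measurableTypeR R * Rn R n :=
  (thead t, [tuple of behead t]).

Let measurable_uncons : measurable_fun setT uncons.
Proof.
by apply: measurable_fun_pair;
  [exact: measurable_tnth|exact: measurable_behead].
Qed.

Let cons_pairK z : uncons (cons_pair z) = z.
Proof. by case: z => x t; congr pair; apply: val_inj. Qed.

Let cons_measure_sigma_finite : sigma_finite setT cons_measure.
Proof.
have /sigma_finiteP[F [TF ndF Foo]] := sigma_finiteT (@lebesgue_measure R).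
have /sigma_finiteP[G [TG ndG Goo]] := sigma_finiteT mu.
exists (fun k => uncons @^-1` (F k `*` G k)).
  rewrite -preimage_bigcup [X in uncons @^-1` X](_ : _ = setT)//.
  rewrite -subTset => -[x t] _.
  have [i _ Fix] : (\bigcup_i F i) x by rewrite -TF.
  have [j _ Gjt] : (\bigcup_i G i) t by rewrite -TG.
  exists (maxn i j) => //; split => /=.
  - by move: x Fix; exact/subsetPset/ndF/leq_maxl.
  - by move: t Gjt; exact/subsetPset/ndG/leq_maxr.
move=> k; have [mF Fk] := Foo k; have [mG Gk] := Goo k; split.
  by rewrite -[X in measurable X]setTI; apply: measurable_uncons => //;
    exact: measurableX.
rewrite /cons_measure (_ : _ @^-1` _ = F k `*` G k); last first.
  by apply/seteqP; split=> z; rewrite /preimage /mkset cons_pairK.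
by rewrite product_measure1E// lte_mul_pinfty// ge0_fin_numE.
Qed.

HB.instance Definition _ := Measure_isSigmaFinite.Build _ _ _
  cons_measure cons_measure_sigma_finite.

End cons_measure.

(* Lebesgue measure on R^n as an iterated product; see lebesgue_tuple_box. *)
Fixpoint lebesgue_tuple (n : nat) :
    {sigma_finite_measure set (Rn R n) -> \bar R} :=
  match n with
  | 0%N => \d_([tuple] : Rn R 0)
  | m.+1 => cons_measure (lebesgue_tuple m)
  end.

Lemma lebesgue_tuple_box n (A : 'I_n -> set (measurableTypeR R)) :
  (forall i, measurable (A i)) ->
  lebesgue_tuple n [set t | forall i, A i (tnth t i)] =
  (\prod_(i < n) lebesgue_measure (A i))%E.
Proof.
elim: n A => [|n IHn] A mA.
  by rewrite big_ord0 /= diracE mem_set// => -[].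
rewrite big_ord_recl -IHn//= /cons_measure -product_measure1E//.
- congr (_ _); apply/seteqP; split=> -[x t] /=.
    move=> h; split; first exact: (h ord0).
    by move=> i; have := h (lift ord0 i); rewrite tnthS.
  move=> [h0 h] i; have [j ->|->//] := unliftP ord0 i.
  by rewrite tnthS; exact: h.
- rewrite (_ : [set _ | _] = \big[setI/setT]_(i < n)
     ((fun t : Rn R n => tnth t i) @^-1` A (lift ord0 i))); last first.
    apply/seteqP; split=> t /=.
      by move=> h; elim/big_ind : _ => // i _; exact: h.
    by move=> h i; move: h; rewrite (bigD1 i)//= => -[].
  apply: bigsetI_measurable => i _.
  by rewrite -[X in measurable X]setTI; exact: measurable_tnth.
Qed.

End lebesgue_tuple.

Notation leb := (lebesgue_tuple _).

(* The pair (c, l) with 0 < l stands for the half-open cube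
   [c_1, c_1 + l[ x ... x [c_n, c_n + l[. *)
Definition cube (R : realType) (n : nat) : Type := (Rn R n * R)%type.

Section cubes.
Context {R : realType} {n : nat}.
Implicit Types (Q : cube R n) (x : Rn R n).

Definition side Q : R := Q.2.

Definition edge Q (i : 'I_n) : set R := `[tnth Q.1 i, tnth Q.1 i + Q.2[.

Definition cube_set Q : set (Rn R n) := [set x | forall i, edge Q i (tnth x i)].

Definition volume Q : R := fine (leb (cube_set Q)).

(* The average is extended-real valued because the averages of w' = w^(1-p')
   in the A_p condition may be infinite. *)
Definition avg Q (f : Rn R n -> R) : \bar R :=
  ((volume Q)^-1%:E * \int[leb]_(x in cube_set Q) (f x)%:E)%E.

Definition dyadic_grid (D : set (cube R n)) : Prop :=
  [/\ forall Q, D Q -> exists k : int, side Q = 2 ^ k,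
      forall k : int,
        partition [set Q | D Q /\ side Q = 2 ^ k] cube_set [set: Rn R n]
    & forall P Q, D P -> D Q ->
        [\/ cube_set P `&` cube_set Q = cube_set P,
            cube_set P `&` cube_set Q = cube_set Q
          | cube_set P `&` cube_set Q = set0]].

End cubes.

Section haar.
Context {R : realType}.

(* h_I^e for I = [c, c + l[; e = true is the noncancellative function. *)
Definition haar1 (c l : R) (e : bool) (t : R) : R :=
  (Num.sqrt l)^-1 *
  (if e then \1_(`[c, c + l[ : set R) t
   else \1_(`[c + l / 2, c + l[ : set R) t - \1_(`[c, c + l / 2[ : set R) t).

Definition haar n (Q : cube R n) (e : {ffun 'I_n -> bool}) (x : Rn R n) : R :=
  \prod_(i < n) haar1 (tnth Q.1 i) (side Q) (e i) (tnth x i).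

Definition pairing n (f g : Rn R n -> R) : R := \int[leb]_x (f x * g x).

End haar.

Section weights.
Context {R : realType} {n : nat}.
Implicit Types (f b w : Rn R n -> R) (D : set (cube R n)).

(* Compactness in R^n is that of row vectors, as tuples carry no topology. *)
Definition loc_integrable f : Prop :=
  measurable_fun setT f /\
  forall K : set (Rn R n),
    compact [set (\row_i (tnth x i : R) : 'rV[R]_n) | x in K] ->
    (\int[leb]_(x in K) `|f x|%:E < +oo)%E.

Definition bmo_norm D b : \bar R :=
  ereal_sup [set avg Q (fun x => `|b x - fine (avg Q b)|) | Q in D].

Definition bmo D b : Prop :=
  loc_integrable b /\ (bmo_norm D b < +oo)%E.

Definition weight w : Prop :=
  loc_integrable w /\ {ae leb, forall x, 0 < w x}.

Definition conjugate_exponent (p : R) : R := (1 - p^-1)^-1.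

Definition dual_weight (p : R) w : Rn R n -> R :=
  fun x => w x `^ (1 - conjugate_exponent p).

Definition Ap_const (p : R) w : \bar R :=
  ereal_sup [set (avg Q w * avg Q (dual_weight p w) `^ (p - 1))%E
            | Q in [set Q : cube R n | 0 < side Q]].

End weights.

Section weighted_measure.
Context {R : realType} {n : nat}.
Variable w : {mfun Rn R n >-> R}.

(* The measure w dx: the absolute value only changes w on a null set when w is
   a weight, and makes the set function nonnegative for every w. *)
Definition wdx (A : set (Rn R n)) : \bar R :=
  (\int[leb]_(x in A) `|w x|%:E)%E.

Let wdx0 : wdx set0 = 0%E.
Proof. exact: integral_set0. Qed.

Let wdx_ge0 A : (0 <= wdx A)%E.
Proof. by apply: integral_ge0 => x _; rewrite lee_fin. Qed.

Let wdx_sigma_additive : semi_sigma_additive wdx.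
Proof.
move=> F mF tF mUF; rewrite /wdx ge0_integral_bigcup//.
  by apply: is_cvg_nneseries => k _ _; exact: wdx_ge0.
apply/measurable_EFinP; apply: (@measurable_funS _ _ _ _ setT) => //.
exact: measurableT_comp.
Qed.

HB.instance Definition _ := isMeasure.Build _ _ _
  wdx wdx0 wdx_ge0 wdx_sigma_additive.

End weighted_measure.

(* The norm of T : L^p(mu) -> L^p(mu), i.e. the least M such that T maps
   L^p(mu) to itself with |T f| <= M |f|; it is +oo if there is no such M. *)
Definition opnorm d (T : measurableType d) (R : realType)
    (mu : {measure set T -> \bar R}) (p : R) (op : (T -> R) -> (T -> R)) :
    \bar R :=
  ereal_inf [set M%:E | M in [set M : R | 0 <= M /\
    forall f : T -> R, f \in Lfun mu p%:E ->
      op f \in Lfun mu p%:E /\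
      ('N[mu]_p%:E[EFin \o op f] <= M%:E * 'N[mu]_p%:E[EFin \o f])%E]].

(* The sum over S of u, as positive part minus negative part; meaningful only
   when u is absolutely summable on S. *)
Definition rsum (R : realType) (I : choiceType) (S : set I) (u : I -> R) : R :=
  fine (\esum_(i in S) (Num.max (u i) 0)%:E) -
  fine (\esum_(i in S) (Num.max (- u i) 0)%:E).

Section paraproduct.
Context {R : realType} {n : nat}.
Implicit Types (D : set (cube R n)) (a b f : Rn R n -> R).

Definition PiPi_term a b f (x : Rn R n) (Q : cube R n) : R :=
  \sum_(e : {ffun 'I_n -> bool} | e != [ffun=> true])
    pairing a (haar Q e) * pairing b (haar Q e) * fine (avg Q f) *
    (\1_(cube_set Q) x / volume Q).

Definition PiPi D a b f : Rn R n -> R :=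
  fun x => rsum D (PiPi_term a b f x).

End paraproduct.

(* Main.v *)
Require Import Defs.
From mathcomp Require Import all_boot all_order all_algebra.
From mathcomp Require Import all_classical all_reals all_analysis.
From mathcomp Require Import measurable_realfun.
From mathcomp Require Import ring lra zify.

Set Implicit Arguments.
Unset Strict Implicit.
Unset Printing Implicit Defensive.
Import Order.TTheory GRing.Theory Num.Theory.
Import numFieldNormedType.Exports.

Local Open Scope classical_set_scope.
Local Open Scope ring_scope.

(** Why the estimate holds.  Write <u>_Q for the average of u over Q, and sigma for
    the dual weight w^(-1/(p-1)).  Pointwise, the operator is at most
      T f = sum_Q alpha_Q <|f|>_Q 1_Q / |Q|,
      alpha_Q = sum_e |(a, h_Q^e)| |(b, h_Q^e)|,
    and what makes T bounded is that alpha is a Carleson sequence: the alpha_Q with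
    Q inside R add up to at most C |a| |b| |R|, where |a| and |b| are the BMO norms
    (haar_product_carleson).  A squared Haar coefficient of a is at most the square
    jump sum_P |P| (<a>_P - <a>_Q)^2 over the 2^n halves P of Q
    (pairing_haar_sqr), so the Carleson condition comes down to one function of
    bounded mean oscillation.  There it is proved by an induction over generations
    in which the constant subtracted from a is replaced by the local average as
    soon as the oscillation around it exceeds twice the norm
    (square_jump_bellman); this plays the part of the John-Nirenberg inequality.

    Testing T f against g = (T f)^(p-1) w turns the bound on the norm into a bound
    on sum_Q alpha_Q <f>_Q <g>_Q.  Put Y_Q = <sigma^(1/2)>_Q^2 and
    Z_Q = <w^(1/2)>_Q^2.  The A_p condition gives
      <sigma>_Q <w>_Q <= [w]^max(1,1/(p-1)) Y_Q^(1/p) Z_Q^(1/p')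
    (Ap_interpolation), the power of the characteristic claimed in the theorem.
    After Young's inequality the form splits into
      sum_Q alpha_Q Y_Q (int_Q f / int_Q sigma)^p   and
      sum_Q alpha_Q Z_Q (int_Q g / int_Q w)^p'.
    The Carleson embedding theorem (carleson_embedding) is used twice on each:
    with Lebesgue measure and exponent 2 it shows that alpha Y is Carleson with
    respect to sigma dx, and alpha Z with respect to w dx; with these measures and
    the exponents p and p' it then bounds the two sums.  The second one is a
    multiple of the norm of T f itself and is absorbed (weighted_form_absorb).

    Both inductions see only finitely many generations below one cube, and only
    through additive functions of cubes.  They are therefore stated for sums over a
    finite piece of an abstract tree.  In a dyadic grid the cubes below Q form such
    a tree, with the 2^n half cubes of Q as children (grid_subcube).  The cubes of
    one generation are a countable partition of the space, so the estimates below
    single cubes add up, and monotone convergence over the generations reaches the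
    sum over the whole grid (grid_sum_majorant). *)

(** * Inequalities between numbers *)

Section scalar_inequalities.
Context {R : realType}.

(** The convex function x^p lies above its tangent at l; inequalities of Hoelder and
    Jensen type follow by summing or integrating with a mean value as l. *)
Lemma powR_tangent (p x l : R) : 1 < p -> 0 <= x -> 0 < l ->
  p * l `^ (p - 1) * x - (p - 1) * l `^ p <= x `^ p.
Proof.
move=> p1 x0 l0.
have p0 : 0 < p by lra.
have q0 : 0 < p / (p - 1) by rewrite divr_gt0//; lra.
have := @conjugate_powR _ x (l `^ (p - 1)) p (p / (p - 1)) x0 (powR_ge0 _ _) p0 q0.
rewrite invf_div -powRrM (_ : (p - 1) * (p / (p - 1)) = p); last by field; lra.
have -> : p^-1 + (p - 1) / p = 1 by field; lra.
move=> /(_ erefl) H.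
rewrite -(ler_pM2l (_ : 0 < p^-1)) ?invr_gt0// mulrBr.
have -> : p^-1 * (p * l `^ (p - 1) * x) = x * l `^ (p - 1) by field; lra.
have -> : p^-1 * ((p - 1) * l `^ p) = l `^ p * ((p - 1) / p) by field; lra.
by rewrite [leRHS]mulrC; lra.
Qed.

Lemma powR_bernoulli (p r : R) : 1 < p -> 0 < r ->
  1 + (p - 1) * (1 - r) <= r `^ (1 - p).
Proof.
move=> p1 r0; rewrite /powR gt_eqF//.
apply: le_trans (expR_ge1Dx _); rewrite lerD2l.
have : ln r <= r - 1 by rewrite -[in ln r](subrKC 1 r) le_ln1Dx//; lra.
by move=> h; nra.
Qed.

(** Subadditivity of the perspective V (phi / V)^p of the power function: sum the
    tangent inequality at the common ratio l. *)
Lemma perspective_sum (I : finType) (p : R) (phi V : I -> R) : 1 < p ->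
  (forall i, 0 <= phi i) -> (forall i, 0 < V i) ->
  (\sum_i V i) * ((\sum_i phi i) / \sum_i V i) `^ p <=
  \sum_i V i * (phi i / V i) `^ p.
Proof.
move=> p1 phi0 V0; set l := (\sum_i phi i) / _.
have rhs0 : 0 <= \sum_i V i * (phi i / V i) `^ p.
  by apply: sumr_ge0 => i _; rewrite mulr_ge0 ?powR_ge0 ?ltW.
have sV : 0 <= \sum_i V i by apply: sumr_ge0 => i _; exact: ltW.
have : 0 <= l by rewrite divr_ge0// sumr_ge0// => i _; exact: ltW.
rewrite le_eqVlt => /predU1P[<-|l0]; first by rewrite powR0 ?mulr0//; lra.
have sV0 : \sum_i V i != 0.
  by apply: contraTneq l0 => h; rewrite /l h invr0 mulr0 ltxx.
apply: (@le_trans _ _ (\sum_i (p * l `^ (p - 1) * phi i - (p - 1) * l `^ p * V i))).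
  rewrite sumrB -!mulr_sumr.
  have -> : \sum_i phi i = l * \sum_i V i by rewrite /l divfK.
  have -> : l `^ p = l * l `^ (p - 1).
    by rewrite mulr_powRB1 ?ltW//; lra.
  lra.
apply: ler_sum => i _.
have x0 : 0 <= phi i / V i by rewrite divr_ge0// ltW.
have := ler_wpM2l (ltW (V0 i)) (powR_tangent p1 x0 l0).
rewrite [X in X <= _ -> _](_ : _ =
  p * l `^ (p - 1) * phi i - (p - 1) * l `^ p * V i)//.
by field; rewrite gt_eqF.
Qed.

(** As a function of V, V (phi / V)^p is convex with derivative - (p - 1) (phi / V)^p, so
    enlarging V by b pays for a Carleson term of size b. *)
Lemma perspective_gain (p phi V b : R) : 1 < p -> 0 <= phi -> 0 < V -> 0 <= b ->
  (p - 1) * b * (phi / (V + b)) `^ p <=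
  V * (phi / V) `^ p - (V + b) * (phi / (V + b)) `^ p.
Proof.
move=> p1 phi0 V0 b0.
have W0 : 0 < V + b by lra.
have -> : V * (phi / V) `^ p =
    (V + b) * (phi / (V + b)) `^ p * (V / (V + b)) `^ (1 - p).
  have -> : phi / V = phi / (V + b) * (V / (V + b))^-1.
    by field; rewrite !gt_eqF.
  set r := V / (V + b); have r0 : 0 < r by rewrite divr_gt0.
  have VE : V = (V + b) * r by rewrite mulrC divfK// gt_eqF.
  have x0 : 0 <= phi / (V + b) by rewrite divr_ge0// ltW.
  rewrite powRM ?invr_ge0 ?(ltW r0)// -[r^-1](powR_inv1 (ltW r0)) -powRrM mulN1r.
  rewrite powRD ?powRr1 ?(ltW r0)//; last by rewrite [r == 0]gt_eqF// implybT.
  by rewrite {1}VE; ring.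
have := powR_bernoulli p1 (divr_gt0 V0 W0).
have -> : 1 - V / (V + b) = b / (V + b) by field; rewrite gt_eqF.
rewrite -(ler_pM2l W0) => h.
have X0 := powR_ge0 (phi / (V + b)) p.
have := ler_wpM2l X0 h.
have -> : (V + b) * (1 + (p - 1) * (b / (V + b))) = V + b + (p - 1) * b.
  by field; rewrite gt_eqF.
lra.
Qed.

Lemma sqr_sum_le (I : finType) (m y : I -> R) :
  (forall i, 0 <= m i) ->
  (\sum_i m i * y i) ^+ 2 <= (\sum_i m i) * \sum_i m i * y i ^+ 2.
Proof.
move=> m0; have M0 : 0 <= \sum_i m i by apply: sumr_ge0.
set M := \sum_i m i in M0 *; set B := \sum_i m i * y i.
have : 0 <= \sum_i m i * (M * y i - B) ^+ 2.
  by apply: sumr_ge0 => i _; rewrite mulr_ge0// sqr_ge0.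
rewrite (eq_bigr (fun i => M ^+ 2 * (m i * y i ^+ 2) - 2 * M * B * (m i * y i) +
   B ^+ 2 * m i)); last by move=> i _; ring.
rewrite big_split sumrB/= -!mulr_sumr -/M -/B.
move: M0; rewrite le_eqVlt => /predU1P[M0 _|M0 h].
  have mi0 i : m i = 0.
    exact: (psumr_eq0P (fun i _ => m0 i) (esym M0)).
  by rewrite -M0 mul0r /B big1 ?expr0n// => i _; rewrite mi0 mul0r.
rewrite -(ler_pM2l M0); lra.
Qed.

Lemma weighted_amgm (s t x y X Y : R) : 0 < s -> 0 < t ->
  x ^+ 2 <= X -> y ^+ 2 <= Y -> x * y <= t / s / 2 * X + s / t / 2 * Y.
Proof.
move=> s0 t0 xX yY.
have h1 := ler_wpM2l (ltW (divr_gt0 t0 s0)) xX.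
have h2 := ler_wpM2l (ltW (divr_gt0 s0 t0)) yY.
have st : 0 <= (s * t)^-1 by rewrite invr_ge0 mulr_ge0 ?ltW.
have := mulr_ge0 st (sqr_ge0 (t * x - s * y)).
have -> : (s * t)^-1 * (t * x - s * y) ^+ 2 =
    t / s * x ^+ 2 + s / t * y ^+ 2 - 2 * (x * y) by field; rewrite !gt_eqF.
lra.
Qed.

(** Young's inequality with a free parameter l, to be chosen when a term is absorbed. *)
Lemma young_scaled (p l Y Z x y : R) : 1 < p -> 0 < l ->
  0 <= Y -> 0 <= Z -> 0 <= x -> 0 <= y ->
  Y `^ p^-1 * Z `^ ((p - 1) / p) * (x * y) <=
  l `^ p * Y * x `^ p / p +
  l `^ (- (p / (p - 1))) * Z * y `^ (p / (p - 1)) / (p / (p - 1)).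
Proof.
move=> p1 l0 Y0 Z0 x0 y0; set q := p / (p - 1).
have p0 : 0 < p by lra.
have q0 : 0 < q by rewrite divr_gt0//; lra.
have pq : p^-1 + q^-1 = 1 by rewrite invf_div; field; lra.
have root_powR r u : 0 < r -> 0 <= u -> (u `^ r^-1) `^ r = u.
  by move=> r0 u0; rewrite -powRrM mulVf ?gt_eqF// powRr1.
rewrite (_ : (p - 1) / p = q^-1); last by rewrite invf_div.
have eY : (l * Y `^ p^-1 * x) `^ p = l `^ p * Y * x `^ p.
  by rewrite !powRM ?root_powR ?powR_ge0 ?(ltW l0)// mulr_ge0 ?powR_ge0 ?(ltW l0).
have eZ : (l^-1 * Z `^ q^-1 * y) `^ q = l `^ (- q) * Z * y `^ q.
  have li0 : 0 <= l^-1 by rewrite invr_ge0 ltW.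
  rewrite !powRM ?root_powR ?powR_ge0//; last by rewrite mulr_ge0 ?powR_ge0.
  by rewrite -[l^-1](powR_inv1 (ltW l0)) -powRrM mulN1r.
rewrite -eY -eZ (_ : _ * _ * (x * y) =
  (l * Y `^ p^-1 * x) * (l^-1 * Z `^ q^-1 * y)).
  apply: conjugate_powR => //; last by rewrite !mulr_ge0 ?powR_ge0 ?invr_ge0 ?(ltW l0).
  by rewrite !mulr_ge0 ?powR_ge0 ?(ltW l0).
by field; rewrite gt_eqF.
Qed.

(** In logarithms all hypotheses are linear.  Here S, W, Y, Z stand for <sigma>, <w>,
    <sigma^(1/2)>^2 and <w^(1/2)>^2.  For p >= 2 one has S W <= A S^(2-p) <= A Y^(2-p),
    and Y^(2-p) <= Y^(1/p) Z^(1/p') is a power of 1 <= Y^(p-1) Z; the case p < 2 is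
    the same with the two weights exchanged. *)
Lemma Ap_interpolation (p W S Y Z A : R) : 1 < p ->
  0 < W -> 0 < S -> 0 < Y -> 0 < Z -> Y <= S -> Z <= W ->
  1 <= Y `^ (p - 1) * Z -> W * S `^ (p - 1) <= A ->
  S * W <= A `^ Num.max 1 (p - 1)^-1 * (Y `^ p^-1 * Z `^ ((p - 1) / p)).
Proof.
move=> p1 W0 S0 Y0 Z0 YS ZW YZ WS.
have A0 : 0 < A by apply: lt_le_trans WS; rewrite mulr_gt0 ?powR_gt0.
have p0 : 0 < p by lra.
rewrite -ler_ln ?posrE ?mulr_gt0 ?powR_gt0// !lnM ?posrE ?mulr_gt0 ?powR_gt0//.
rewrite !ln_powR.
have lYS : ln Y <= ln S by rewrite ler_ln.
have lZW : ln Z <= ln W by rewrite ler_ln.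
have lYZ : 0 <= (p - 1) * ln Y + ln Z.
  by rewrite -ln_powR -lnM ?posrE ?powR_gt0// -(@ln1 R) ler_ln ?posrE ?mulr_gt0 ?powR_gt0.
have lWS : ln W + (p - 1) * ln S <= ln A.
  by rewrite -ln_powR -lnM ?posrE ?powR_gt0// ler_ln ?posrE ?mulr_gt0 ?powR_gt0.
move: (ln Y) (ln S) (ln Z) (ln W) (ln A) lYS lZW lYZ lWS => y s z w a ys zw yz ws.
(* E is used for p >= 2 and E2 for p < 2; both isolate the quantity (p - 1) y + z >= 0. *)
have E : p^-1 * y + (p - 1) / p * z =
    ((p - 1) * ((p - 1) * y + z)) / p - (p - 2) * y by field; lra.
have E2 : p^-1 * y + (p - 1) / p * z =
    ((p - 1) * y + z) / (p * (p - 1)) + (p - 2) / (p - 1) * z.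
  by field; apply/andP; split; lra.
have [p2|p2] := leP 2 p.
  have -> : Num.max 1 (p - 1)^-1 = 1.
    by apply/max_idPl; rewrite invf_le1; lra.
  have h : 0 <= ((p - 1) * ((p - 1) * y + z)) / p.
    by rewrite divr_ge0 ?mulr_ge0//; lra.
  have := ler_wpM2l (_ : 0 <= p - 2) ys; rewrite subr_ge0 p2 => /(_ isT) h2.
  by rewrite E mul1r; lra.
have -> : Num.max 1 (p - 1)^-1 = (p - 1)^-1.
  by apply/max_idPr; rewrite invf_ge1; lra.
have q0 : 0 < (p - 1)^-1 by rewrite invr_gt0; lra.
have h : 0 <= ((p - 1) * y + z) / (p * (p - 1)).
  by rewrite divr_ge0 ?mulr_ge0//; lra.
have h1 := ler_wpM2l (ltW q0) ws.
have h2 : (2 - p) / (p - 1) * z <= (2 - p) / (p - 1) * w.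
  by rewrite ler_wpM2l ?mulr_ge0 ?(ltW q0)//; lra.
have e1 : (p - 1)^-1 * (w + (p - 1) * s) = (2 - p) / (p - 1) * w + w + s.
  by field; lra.
have e2 : (p - 2) / (p - 1) * z = - ((2 - p) / (p - 1) * z) by field; lra.
by rewrite E2 e2; move: h1; rewrite e1; lra.
Qed.

(** The hypothesis is Jensen's inequality for the density sigma^(1/2), with h, g the
    integrals of sigma^(1/2) and w^(1/2) over a cube of measure m.  It says that
    1 <= (h / m)^(p - 1) (g / m), and the conclusion is the square of this. *)
Lemma jensen_product_ge1 (p m h g : R) : 1 < p -> 0 < m -> 0 < h ->
  0 <= g -> h * (m / h) `^ p <= g ->
  1 <= ((h / m) `^ 2) `^ (p - 1) * (g / m) `^ 2.
Proof.
move=> p1 m0 h0 g0 hg.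
have r0 : 0 < h / m by rewrite divr_gt0.
have gm0 : 0 <= g / m by rewrite divr_ge0// ltW.
have hg1 : 1 <= (h / m) `^ (p - 1) * (g / m).
  have mh : (m / h) `^ p = ((h / m) `^ p)^-1.
    by rewrite -powRN -mulN1r powRrM powR_inv1 ?(ltW r0)// invf_div.
  move: hg; rewrite mh -(mulr_powRB1 (ltW r0)); last by lra.
  set X := (h / m) `^ (p - 1).
  have X0 : 0 < X by exact: powR_gt0.
  have -> : h * (h / m * X)^-1 = m / X by field; rewrite !gt_eqF.
  by rewrite ler_pdivrMr// mulrA ler_pdivlMr// mul1r mulrC.
rewrite -powRrM [2 * _]mulrC powRrM -powRM ?powR_ge0//.
by rewrite (powR_mulrn 2 (mulr_ge0 (powR_ge0 _ _) gm0)) exprn_ege1.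
Qed.

End scalar_inequalities.

(** * Finite sums over a tree and Carleson embedding *)

Section tree.
Context {R : realType} {T : Type} {I : finType} (child : T -> I -> T).
Variable D : set T.
Hypothesis Dchild : forall Q i, D Q -> D (child Q i).

(** N counts the generations, that of Q itself included. *)
Fixpoint tree_sum N (F : T -> R) (Q : T) : R :=
  if N is N'.+1 then F Q + \sum_i tree_sum N' F (child Q i) else 0.

Definition tree_additive (m : T -> R) : Prop :=
  forall Q, D Q -> m Q = \sum_i m (child Q i).

Lemma tree_sumD N F G Q :
  tree_sum N (fun P => F P + G P) Q = tree_sum N F Q + tree_sum N G Q.
Proof.
elim: N Q => [|N IH] Q /=; first by rewrite addr0.
by rewrite (eq_bigr _ (fun i _ => IH (child Q i))) big_split/= addrACA.
Qed.

Lemma tree_sumZ N c F Q :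
  tree_sum N (fun P => c * F P) Q = c * tree_sum N F Q.
Proof.
elim: N Q => [|N IH] Q /=; first by rewrite mulr0.
by rewrite (eq_bigr _ (fun i _ => IH (child Q i))) -mulr_sumr mulrDr.
Qed.

Lemma ler_tree_sum N F G Q : D Q -> (forall P, D P -> F P <= G P) ->
  tree_sum N F Q <= tree_sum N G Q.
Proof.
move=> DQ FG; elim: N Q DQ => [//|N IH] Q DQ /=.
by rewrite lerD ?FG// ler_sum// => i _; exact/IH/Dchild.
Qed.

Lemma tree_sum_ge0 N F Q : D Q -> (forall P, D P -> 0 <= F P) ->
  0 <= tree_sum N F Q.
Proof.
move=> DQ F0; elim: N Q DQ => [//|N IH] Q DQ /=.
by rewrite addr_ge0 ?F0// sumr_ge0// => i _; exact/IH/Dchild.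
Qed.

(** Induction on the number of generations, with the Bellman function
    Phi - V (phi / V)^p for V = mu + tree_sum N beta.  Passing from the children to Q,
    the perspective term only decreases (perspective_sum), and adding beta Q to V
    gains a multiple of beta Q (phi / V)^p (perspective_gain); the Carleson condition
    keeps V below 2 mu, which turns this into beta Q (phi / mu)^p. *)
Lemma carleson_embedding_bellman (p : R) (mu phi Phi beta : T -> R) : 1 < p ->
  tree_additive mu -> tree_additive phi -> tree_additive Phi ->
  (forall Q, D Q -> 0 < mu Q) -> (forall Q, D Q -> 0 <= phi Q) ->
  (forall Q, D Q -> mu Q * (phi Q / mu Q) `^ p <= Phi Q) ->
  (forall Q, D Q -> 0 <= beta Q) ->
  (forall N Q, D Q -> tree_sum N beta Q <= mu Q) ->
  forall N Q, D Q -> tree_sum N (fun P => beta P * (phi P / mu P) `^ p) Q <=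
    2 `^ p / (p - 1) *
    (Phi Q - (mu Q + tree_sum N beta Q) * (phi Q / (mu Q + tree_sum N beta Q)) `^ p).
Proof.
move=> p1 amu aphi aPhi mu0 phi0 jen b0 car.
have C0 : 0 < 2 `^ p / (p - 1) by rewrite divr_gt0 ?powR_gt0//; lra.
elim=> [|N IH] Q DQ /=.
  by rewrite addr0 mulr_ge0 ?subr_ge0 ?jen// ltW.
set V := fun P => mu P + tree_sum N beta P.
have V0 P : D P -> 0 < V P by move=> DP; rewrite ltr_wpDr ?mu0 ?tree_sum_ge0.
have sV : mu Q + (beta Q + \sum_i tree_sum N beta (child Q i)) =
    \sum_i V (child Q i) + beta Q.
  by rewrite /V big_split/= -amu//; lra.
rewrite sV.
have Vle : \sum_i V (child Q i) + beta Q <= 2 * mu Q.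
  by rewrite -sV; have := car N.+1 _ DQ => /=; lra.
have h1 : \sum_i tree_sum N (fun P => beta P * (phi P / mu P) `^ p) (child Q i) <=
    2 `^ p / (p - 1) * (Phi Q - (\sum_i V (child Q i)) *
      (phi Q / \sum_i V (child Q i)) `^ p).
  apply: le_trans (ler_sum _ (fun i _ => IH _ (Dchild i DQ))) _.
  rewrite -mulr_sumr ler_pM2l// sumrB -aPhi// lerB// (aphi _ DQ).
  rewrite (perspective_sum (phi := fun i => phi (child Q i))
    (V := fun i => V (child Q i)))// => i; [exact/phi0/Dchild|exact/V0/Dchild].
have sV0 : 0 <= \sum_i V (child Q i).
  by apply: sumr_ge0 => i _; exact/ltW/V0/Dchild.
move: sV0; rewrite le_eqVlt => /predU1P[/esym sV0|sV0].
  exfalso; have := mu0 _ DQ; rewrite amu//.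
  suff : \sum_i mu (child Q i) <= 0 by lra.
  rewrite -[leRHS]sV0; apply: ler_sum => i _.
  by rewrite /V lerDl tree_sum_ge0//; exact: Dchild.
have h2 := perspective_gain p1 (phi0 _ DQ) sV0 (b0 _ DQ).
have h3 : beta Q * (phi Q / mu Q) `^ p <= 2 `^ p / (p - 1) *
   ((p - 1) * beta Q * (phi Q / (\sum_i V (child Q i) + beta Q)) `^ p).
  have -> : forall x, 2 `^ p / (p - 1) * ((p - 1) * beta Q * x `^ p) =
     beta Q * (2 `^ p * x `^ p) by move=> x; field; lra.
  have W0 : 0 < \sum_i V (child Q i) + beta Q by rewrite ltr_wpDr ?b0.
  rewrite ler_wpM2l ?b0// -powRM//; last by rewrite divr_ge0 ?phi0// ltW.
  rewrite ge0_ler_powR ?nnegrE//; [by lra|by rewrite divr_ge0 ?phi0 ?ltW ?mu0| | ].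
    by rewrite mulr_ge0// divr_ge0 ?phi0// ltW.
  rewrite mulrCA ler_wpM2l ?phi0// -(invrK 2) -invfM lef_pV2 ?posrE ?mu0//.
    by lra.
  by rewrite mulr_gt0// invr_gt0.
have := ler_wpM2l (ltW C0) h2; move: h1 h3; clear.
by move: (2 `^ p / (p - 1)) => C; lra.
Qed.

(** The Carleson embedding theorem for an additive phi = f mu, where Phi plays the role
    of f^p mu. *)
Lemma carleson_embedding (p k : R) (mu phi Phi beta : T -> R) : 1 < p -> 0 <= k ->
  tree_additive mu -> tree_additive phi -> tree_additive Phi ->
  (forall Q, D Q -> 0 < mu Q) -> (forall Q, D Q -> 0 <= phi Q) ->
  (forall Q, D Q -> mu Q * (phi Q / mu Q) `^ p <= Phi Q) ->
  (forall Q, D Q -> 0 <= beta Q) ->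
  (forall N Q, D Q -> tree_sum N beta Q <= k * mu Q) ->
  forall N Q, D Q -> tree_sum N (fun P => beta P * (phi P / mu P) `^ p) Q <=
    k * (2 `^ p / (p - 1)) * Phi Q.
Proof.
move=> p1; rewrite le_eqVlt => /predU1P[<-|k0] amu aphi aPhi mu0 phi0 jen b0 car N Q DQ.
  (* With k = 0 the Carleson condition for one generation forces beta to vanish. *)
  have bE P : D P -> beta P <= 0.
    move=> DP; have := car 1%N _ DP => /=.
    by rewrite big1 ?addr0 ?mul0r.
  rewrite !mul0r.
  apply: (@le_trans _ _ (tree_sum N (fun P => 0 * beta P) Q)); last first.
    by rewrite tree_sumZ mul0r.
  apply: ler_tree_sum => // P DP; rewrite mul0r.
  by rewrite mulr_le0_ge0 ?powR_ge0 ?bE.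
have b0' P : D P -> 0 <= k^-1 * beta P.
  by move=> DP; rewrite mulr_ge0 ?b0// invr_ge0 ltW.
have h := carleson_embedding_bellman p1 amu aphi aPhi mu0 phi0 jen b0' _ N DQ.
have {}h : k^-1 * tree_sum N (fun P => beta P * (phi P / mu P) `^ p) Q <=
    2 `^ p / (p - 1) * Phi Q.
  rewrite -tree_sumZ.
  rewrite (_ : (fun P => k^-1 * _) =
     (fun P => k^-1 * beta P * (phi P / mu P) `^ p)); last first.
    by apply/funext => P; rewrite mulrA.
  apply: (le_trans (h _)) => [M P DP|].
    by rewrite tree_sumZ mulrC ler_pdivrMr// mulrC car.
  rewrite ler_wpM2l ?divr_ge0 ?powR_ge0//; first lra.
  rewrite gerBl mulr_ge0 ?powR_ge0// addr_ge0 ?tree_sum_ge0//.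
  by rewrite ltW// mu0.
by move: h; rewrite mulrC ler_pdivrMr// => h; lra.
Qed.

(** * Square jumps of functions of bounded mean oscillation *)

(** Here A stands for the integral of a function a, and V c for that of |a - c|. *)
Section bmo.
Variables (d M : R) (m A : T -> R) (V : R -> T -> R).
Hypothesis am : tree_additive m.
Hypothesis aA : tree_additive A.
Hypothesis aV : forall c, tree_additive (V c).
Hypothesis m0 : forall Q, D Q -> 0 < m Q.
Hypothesis M0 : 0 <= M.
Hypothesis doubling : forall Q i, D Q -> m Q <= d * m (child Q i).
Hypothesis VA : forall c Q, D Q -> `|A Q - c * m Q| <= V c Q.
Hypothesis osc : forall Q, D Q -> V (A Q / m Q) Q <= M * m Q.

Definition square_jump Q :=
  \sum_i m (child Q i) * (A (child Q i) / m (child Q i) - A Q / m Q) ^+ 2.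

(** The expected value of |a_P - a_Q|^2 - |a_P - c|^2 over the children P of Q is
    - |a_Q - c|^2, so the bound is preserved by averaging over children on which V c
    stays below 2 M m.  On the other children c is replaced by the average of a; the
    mean oscillation falls from more than 2 M to at most M, and the coefficient
    4 d^2 M makes this drop pay for the square |a_P - c|^2, which doubling bounds by
    4 d^2 M^2. *)
Lemma square_jump_bellman N Q c : D Q -> V c Q <= 2 * M * m Q ->
  tree_sum N square_jump Q <=
  4 * M ^+ 2 * m Q - m Q * (A Q / m Q - c) ^+ 2 + 4 * d ^+ 2 * M * V c Q.
Proof.
have V0 c' P : D P -> 0 <= V c' P.
  by move=> DP; apply: le_trans (VA c' DP); exact: normr_ge0.
have dev P c' K : D P -> V c' P <= K * m P ->
    m P * (A P / m P - c') ^+ 2 <= K ^+ 2 * m P.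
  move=> DP VK; rewrite mulrC ler_wpM2r ?(ltW (m0 DP))//.
  have -> : A P / m P - c' = (A P - c' * m P) / m P.
    by field; rewrite gt_eqF ?m0.
  rewrite -real_normK ?num_real// ler_sqr ?nnegrE//; last first.
    by rewrite -(pmulr_lge0 _ (m0 DP)); apply: le_trans VK; exact: V0.
  rewrite normrM normfV (gtr0_norm (m0 DP)) ler_pdivrMr ?m0//.
  exact: le_trans (VA c' DP) VK.
have d0 : 0 <= 4 * d ^+ 2 * M by rewrite mulr_ge0// mulr_ge0// sqr_ge0.
elim: N Q c => [|N IH] Q c DQ VQ.
  have := dev _ _ _ DQ VQ; have := V0 c _ DQ => h1 h2 /=.
  have : 0 <= 4 * d ^+ 2 * M * V c Q by rewrite mulr_ge0// d0.
  lra.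
rewrite /=; pose G P := 4 * M ^+ 2 * m P - m P * (A P / m P - c) ^+ 2 +
  4 * d ^+ 2 * M * V c P.
have step i : tree_sum N square_jump (child Q i) <= G (child Q i).
  have DP := Dchild i DQ; set P := child Q i in DP *.
  have [VP|VP] := leP (V c P) (2 * M * m P); first exact: IH.
  (* On this child the induction hypothesis is used around the average of a. *)
  have h := IH P (A P / m P) DP (le_trans (osc DP) _).
  apply: le_trans (h _) _.
    by rewrite -[leRHS]mulrA ler_peMl ?mulr_ge0 ?(ltW (m0 DP))// ler1n.
  have Vd : V c P <= 2 * M * d * m P.
    apply: (@le_trans _ _ (V c Q)).
      rewrite [leRHS]aV// (bigD1 i)//= lerDl sumr_ge0// => j _.
      exact/V0/Dchild.
    apply: (le_trans VQ); rewrite -[leRHS]mulrA ler_wpM2l ?mulr_ge0//.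
    exact: doubling.
  have h2 := dev _ _ _ DP Vd.
  have h3 := ler_wpM2l d0 (ltW VP).
  have h4 := ler_wpM2l d0 (osc DP).
  rewrite /G subrr expr0n/= mulr0; move: h2 h3 h4.
  rewrite !exprMn; lra.
apply: le_trans (lerD (lexx _) (ler_sum _ (fun i _ => step i))) _.
rewrite /square_jump /G !big_split/= sumrN.
rewrite -!mulr_sumr -am// -aV//.
suff : \sum_i m (child Q i) * (A (child Q i) / m (child Q i) - A Q / m Q) ^+ 2 -
   \sum_i m (child Q i) * (A (child Q i) / m (child Q i) - c) ^+ 2 =
   - (m Q * (A Q / m Q - c) ^+ 2) by lra.
rewrite -sumrB (eq_bigr (fun i => (A Q / m Q ^+ 1 * (A Q / m Q) - c ^+ 2) *
   m (child Q i) - 2 * (A Q / m Q - c) * A (child Q i))); last first.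
  move=> i _; field; rewrite !gt_eqF ?m0//; exact: Dchild.
rewrite sumrB -!mulr_sumr -am// -aA//; field.
by rewrite gt_eqF ?m0.
Qed.

Lemma square_jump_carleson N Q : D Q ->
  tree_sum N square_jump Q <= (4 + 4 * d ^+ 2) * M ^+ 2 * m Q.
Proof.
move=> DQ; have := @square_jump_bellman N Q (A Q / m Q) DQ.
have osc2 : V (A Q / m Q) Q <= 2 * M * m Q.
  by apply: le_trans (osc DQ) _; rewrite -[leRHS]mulrA ler_peMl ?mulr_ge0 ?(ltW (m0 DQ))// ler1n.
move=> /(_ osc2); rewrite subrr expr0n/= mulr0.
have d0 : 0 <= 4 * d ^+ 2 * M by rewrite mulr_ge0// mulr_ge0// sqr_ge0.
have := ler_wpM2l d0 (osc DQ); lra.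
Qed.
End bmo.

(** * The weighted bilinear form on a tree *)

Definition embedding_constant (p : R) : R := 4 * (2 `^ p / (p - 1)) / p.

Definition form_constant (p : R) : R :=
  2 * embedding_constant p * (2 * embedding_constant (p / (p - 1))) `^ (p - 1).

Lemma embedding_constant_gt0 (p : R) : 1 < p -> 0 < embedding_constant p.
Proof.
by move=> p1; rewrite divr_gt0 ?mulr_gt0// ?invr_gt0 ?powR_gt0//; lra.
Qed.

Lemma form_constant_ge0 (p : R) : 1 < p -> 0 <= form_constant p.
Proof.
move=> p1; rewrite mulr_ge0 ?powR_ge0// mulr_ge0//.
exact/ltW/embedding_constant_gt0.
Qed.

(** The additive functions m, sigma, w are the Lebesgue measure of a cube and the
    integrals of the two weights; hs, hw are the integrals of the square roots of the
    weights, phi and gam those of f and g, Phi and Gam those of f^p w and of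
    g^p' w^(1-p'). *)
Section weighted.
Variables (p k : R) (A : R) (m sigma w hs hw phi Phi gam Gam alpha : T -> R).
Hypothesis p1 : 1 < p.
Let p' := p / (p - 1).
Hypotheses (am : tree_additive m) (as_ : tree_additive sigma)
  (aw : tree_additive w) (ahs : tree_additive hs) (ahw : tree_additive hw)
  (aphi : tree_additive phi) (aPhi : tree_additive Phi)
  (agam : tree_additive gam) (aGam : tree_additive Gam).
Hypotheses (m0 : forall Q, D Q -> 0 < m Q) (s0 : forall Q, D Q -> 0 < sigma Q)
  (w0 : forall Q, D Q -> 0 < w Q) (hs0 : forall Q, D Q -> 0 < hs Q)
  (hw0 : forall Q, D Q -> 0 < hw Q) (phi0 : forall Q, D Q -> 0 <= phi Q)
  (gam0 : forall Q, D Q -> 0 <= gam Q).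
Hypotheses
  (jhs : forall Q, D Q -> m Q * (hs Q / m Q) `^ 2 <= sigma Q)
  (jhw : forall Q, D Q -> m Q * (hw Q / m Q) `^ 2 <= w Q)
  (jphi : forall Q, D Q -> sigma Q * (phi Q / sigma Q) `^ p <= Phi Q)
  (jgam : forall Q, D Q -> w Q * (gam Q / w Q) `^ p' <= Gam Q)
  (dual : forall Q, D Q -> 1 <= ((hs Q / m Q) `^ 2) `^ (p - 1) * (hw Q / m Q) `^ 2)
  (Ap : forall Q, D Q -> (w Q / m Q) * (sigma Q / m Q) `^ (p - 1) <= A)
  (k0 : 0 <= k) (alpha0 : forall Q, D Q -> 0 <= alpha Q)
  (car : forall N Q, D Q -> tree_sum N alpha Q <= k * m Q).

Let W := A `^ Num.max 1 (p - 1)^-1.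
Let C1 := embedding_constant p.
Let C2 := embedding_constant p'.

(** Each term is split by Ap_interpolation and Young's inequality; each of
    the two resulting sums is bounded by applying carleson_embedding twice. *)
Lemma weighted_form_young N Q (l : R) : D Q -> 0 < l ->
  tree_sum N (fun P => alpha P * (phi P / m P) * (gam P / m P)) Q <=
  W * k * (l `^ p * C1 * Phi Q + l `^ (- p') * C2 * Gam Q).
Proof.
move=> DQ l0.
have p1r := p1; have p0 : 0 < p by lra.
have p'0 : 0 < p' by rewrite divr_gt0//; lra.
have p'1 : 1 < p' by rewrite ltr_pdivlMr; lra.
have pp' : p^-1 + p'^-1 = 1 by rewrite invf_div; field; lra.
pose aY P := alpha P * (hs P / m P) `^ 2.
pose aZ P := alpha P * (hw P / m P) `^ 2.
have n2 : 1 < 2 :> R by rewrite ltr1n.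
have four : 2 `^ 2 / (2 - 1) = 4 :> R.
  by rewrite powR_mulrn// (_ : 2 - 1 = 1); [rewrite divr1; lra|lra].
have cY M P : D P -> tree_sum M aY P <= (k * 4) * sigma P.
  rewrite -four; apply: carleson_embedding => // P' DP'; exact/ltW/hs0.
have cZ M P : D P -> tree_sum M aZ P <= (k * 4) * w P.
  rewrite -four; apply: carleson_embedding => // P' DP'; exact/ltW/hw0.
have aY0 P : D P -> 0 <= aY P by move=> DP; rewrite mulr_ge0 ?alpha0 ?powR_ge0.
have aZ0 P : D P -> 0 <= aZ P by move=> DP; rewrite mulr_ge0 ?alpha0 ?powR_ge0.
have k40 : 0 <= k * 4 by rewrite mulr_ge0.
have hY := @carleson_embedding p (k * 4) sigma phi Phi aY p1 k40 as_ aphi aPhi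
  s0 phi0 jphi aY0 cY N Q DQ.
have hZ := @carleson_embedding p' (k * 4) w gam Gam aZ p'1 k40 aw agam aGam
  w0 gam0 jgam aZ0 cZ N Q DQ.
have W0 : 0 <= W by exact: powR_ge0.
apply: (@le_trans _ _ (tree_sum N (fun P =>
    W * (l `^ p / p * (aY P * (phi P / sigma P) `^ p) +
         l `^ (- p') / p' * (aZ P * (gam P / w P) `^ p'))) Q)).
  apply: ler_tree_sum => // P DP.
  have mP := m0 DP; have sP := s0 DP; have wP := w0 DP.
  have e2 := Ap_interpolation p1 (divr_gt0 wP mP) (divr_gt0 sP mP)
    (powR_gt0 2 (divr_gt0 (hs0 DP) mP)) (powR_gt0 2 (divr_gt0 (hw0 DP) mP)).
  have {e2} := e2 A _ _ (dual DP) (Ap DP).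
  rewrite !ler_pdivlMr// ![_ `^ 2 * m P]mulrC => /(_ (jhs DP) (jhw DP)).
  rewrite -/W; set Y := (hs P / m P) `^ 2; set Z := (hw P / m P) `^ 2 => h.
  have Y0 : 0 <= Y by exact: powR_ge0.
  have Z0 : 0 <= Z by exact: powR_ge0.
  have a0 : 0 <= phi P / sigma P by rewrite divr_ge0 ?phi0// ltW.
  have b0 : 0 <= gam P / w P by rewrite divr_ge0 ?gam0// ltW.
  have -> : alpha P * (phi P / m P) * (gam P / m P) = alpha P *
     (sigma P / m P * (w P / m P) * ((phi P / sigma P) * (gam P / w P))).
    by field; rewrite !gt_eqF.
  have -> : W * (l `^ p / p * (aY P * (phi P / sigma P) `^ p) +
         l `^ (- p') / p' * (aZ P * (gam P / w P) `^ p')) =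
     alpha P * (W * (l `^ p * Y * (phi P / sigma P) `^ p / p +
         l `^ (- p') * Z * (gam P / w P) `^ p' / p')).
    by rewrite /aY /aZ -/Y -/Z; ring.
  rewrite ler_wpM2l ?alpha0//.
  apply: (@le_trans _ _ (W * (Y `^ p^-1 * Z `^ ((p - 1) / p)) *
      ((phi P / sigma P) * (gam P / w P)))).
    by rewrite ler_wpM2r// mulr_ge0.
  rewrite -mulrA ler_wpM2l//.
  exact: young_scaled.
rewrite tree_sumZ tree_sumD !tree_sumZ -[leRHS]mulrA ler_wpM2l//.
have -> : k * (l `^ p * C1 * Phi Q + l `^ (- p') * C2 * Gam Q) =
  l `^ p / p * (k * 4 * (2 `^ p / (p - 1)) * Phi Q) +
  l `^ (- p') / p' * (k * 4 * (2 `^ p' / (p' - 1)) * Gam Q).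
  by rewrite /C1 /C2 /embedding_constant; ring.
by rewrite lerD// ler_wpM2l// divr_ge0 ?powR_ge0 ?(ltW p0) ?(ltW p'0).
Qed.

(** The parameter l is chosen so that the term in Gam is at most half of Gam. *)
Lemma weighted_form_absorb N Q : D Q -> 0 <= Phi Q ->
  Gam Q <= tree_sum N (fun P => alpha P * (phi P / m P) * (gam P / m P)) Q ->
  Gam Q <= form_constant p * (W * k) `^ p * Phi Q.
Proof.
move=> DQ Phi0 h; rewrite /form_constant -/p' -/C1 -/C2.
have p1r := p1; have p0 : 0 < p by lra.
have p'0 : 0 < p' by rewrite divr_gt0//; lra.
have p'1 : 1 < p' by rewrite ltr_pdivlMr; lra.
have C10 : 0 < C1 by exact: embedding_constant_gt0.
have C20 : 0 < C2 by exact: embedding_constant_gt0.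
have A0 : 0 < A.
  by apply: lt_le_trans (Ap DQ); rewrite mulr_gt0 ?powR_gt0 ?divr_gt0 ?w0 ?m0 ?s0.
have W0 : 0 < W by rewrite powR_gt0.
have [kz|kz] := eqVneq k 0.
  have := weighted_form_young N DQ ltr01; rewrite kz mulr0 mul0r => h2.
  by rewrite powR0 ?gt_eqF// mulr0 mul0r (le_trans h).
have K0 : 0 < W * k by rewrite mulr_gt0// lt_def kz.
set K := W * k in K0 *.
have e0 : 0 < 2 * C2 * K by rewrite mulr_gt0// mulr_gt0.
have := weighted_form_young N DQ (powR_gt0 p'^-1 e0); rewrite -/K => /(le_trans h).
rewrite -!powRrM mulrN mulVf ?gt_eqF// powR_inv1 ?(ltW e0)//.
rewrite (_ : p'^-1 * p = p - 1); last by rewrite /p'; field; apply/andP; split; lra.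
rewrite mulrDr (_ : K * ((2 * C2 * K)^-1 * C2 * Gam Q) = Gam Q / 2); last first.
  by field; rewrite !gt_eqF.
rewrite powRM ?(ltW K0) ?(mulr_ge0 _ (ltW C20))//.
rewrite -(mulr_powRB1 (ltW K0) p0).
set X := (2 * C2) `^ (p - 1); lra.
Qed.
End weighted.
End tree.

(** * Geometry of dyadic grids *)

Section cube_geometry.
Context {R : realType} {n : nat}.
Implicit Types (Q : cube R n) (x : Rn R n) (d : {ffun 'I_n -> bool}).

(** The half cubes of Q, indexed by the corner d of the unit cube towards which they lie;
    grid_subcube shows that they belong to every dyadic grid that contains Q. *)
Definition subcube Q d : cube R n :=
  ([tuple tnth Q.1 i + (d i)%:R * (Q.2 / 2) | i < n], Q.2 / 2).

Definition subcube_index Q x : {ffun 'I_n -> bool} :=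
  [ffun i => tnth Q.1 i + Q.2 / 2 <= tnth x i].

Lemma cube_setP Q x :
  cube_set Q x <-> forall i, tnth Q.1 i <= tnth x i < tnth Q.1 i + Q.2.
Proof. by split=> h i; have := h i; rewrite /edge /= in_itv. Qed.

Lemma cube_set_subcubeE Q d x : 0 < side Q ->
  cube_set (subcube Q d) x <-> cube_set Q x /\ d = subcube_index Q x.
Proof.
rewrite /side => l0; rewrite !cube_setP /=; split=> [h|[h ->]].
  split=> [i|].
    by have := h i; rewrite tnth_mktuple; case: (d i); rewrite ?mul1r ?mul0r; lra.
  apply/ffunP => i; have := h i; rewrite ffunE tnth_mktuple.
  by case: (d i); rewrite ?mul1r ?mul0r => hi; apply/esym; [|apply/negbTE]; lra.
move=> i; have := h i; rewrite tnth_mktuple ffunE.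
by have [h1|h1] := leP (tnth Q.1 i + Q.2 / 2) (tnth x i);
  rewrite ?mul1r ?mul0r; lra.
Qed.

Lemma cube_set_subcube Q d : 0 < side Q -> cube_set (subcube Q d) `<=` cube_set Q.
Proof. by move=> Q0 x /cube_set_subcubeE[]. Qed.

Lemma side_subcube Q d : side (subcube Q d) = side Q / 2. Proof. by []. Qed.

Lemma measurable_edge Q i : measurable (edge Q i).
Proof. exact: measurable_itv. Qed.

Lemma measurable_cube_set Q : measurable (cube_set Q).
Proof.
rewrite (_ : cube_set Q = \big[setI/setT]_(i < n)
   ((fun t : Rn R n => tnth t i) @^-1` edge Q i)); last first.
  apply/seteqP; split=> t /=.
    by move=> h; elim/big_ind : _ => // i _; exact: h.
  by move=> h i; move: h; rewrite (bigD1 i)//= => -[].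
apply: bigsetI_measurable => i _.
rewrite -[X in measurable X]setTI; apply: measurable_tnth => //.
exact: measurable_edge.
Qed.

Lemma leb_cube_set Q : 0 <= side Q -> leb (cube_set Q) = (side Q ^+ n)%:E.
Proof.
rewrite /side => l0; rewrite lebesgue_tuple_box; last exact: measurable_edge.
rewrite (eq_bigr (fun=> Q.2%:E)); last first.
  move=> i _; rewrite /edge lebesgue_measure_itv/= lte_fin ltrDl.
  have [Q0|] := ltP 0 Q.2; first by rewrite -EFinB addrAC subrr add0r.
  by move=> Q0; congr EFin; apply/esym/le_anti/andP.
by rewrite prodEFin prodr_const card_ord.
Qed.
End cube_geometry.

Section grid_geometry.
Context {R : realType} {n : nat}.
Hypothesis hn : (0 < n)%N.
Variable D : set (cube R n).
Hypothesis gridD : dyadic_grid D.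
Implicit Types (Q : cube R n) (x : Rn R n) (d : {ffun 'I_n -> bool}).

Definition generation (k : int) : set (cube R n) :=
  [set Q | D Q /\ side Q = 2 ^ k].

Lemma grid_side_gt0 Q : D Q -> 0 < side Q.
Proof. by case: gridD => h _ _ /h[k ->]; rewrite exprz_gt0. Qed.

Lemma generation_ex k x : exists2 Q, generation k Q & cube_set Q x.
Proof.
case: gridD => _ /(_ k)[h _ _] _.
by have : setT x by []; rewrite -h => -[Q]; exists Q.
Qed.

Lemma generation_uniq k P Q x : generation k P -> generation k Q ->
  cube_set P x -> cube_set Q x -> P = Q.
Proof.
case: gridD => _ /(_ k)[_ + _] _ => h gP gQ Px Qx.
by apply: (h P Q) => //; exists x.
Qed.

Lemma half_exprz (k : int) : 2 ^ k / 2 = 2 ^ (k - 1) :> R.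
Proof. by rewrite expfzDr// -invr_expz. Qed.

(** Nestedness of the grid: since P cannot contain the larger cube Q, it lies inside Q. *)
Lemma half_cube_corner P Q x i : D P -> D Q -> side P = side Q / 2 ->
  cube_set P x -> cube_set Q x ->
  tnth Q.1 i <= tnth P.1 i <= tnth Q.1 i + side Q / 2.
Proof.
move=> DP DQ PQ Px Qx; have l0 := grid_side_gt0 DQ.
rewrite /side in PQ l0 *.
have PsubQ : cube_set P `<=` cube_set Q.
  case: gridD => _ _ /(_ _ _ DP DQ)[|h|h].
  - by move/setIidPl.
  - exfalso; have QP : cube_set Q `<=` cube_set P by apply/setIidPr.
    have c1 : cube_set Q Q.1 by apply/cube_setP => j; lra.
    have c2 : cube_set Q [tuple tnth Q.1 j + Q.2 / 2 | j < n].
      by apply/cube_setP => j; rewrite tnth_mktuple; lra.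
    have /cube_setP/(_ (Ordinal hn)) := QP _ c1.
    have /cube_setP/(_ (Ordinal hn)) := QP _ c2.
    by rewrite tnth_mktuple PQ; lra.
  - by exfalso; have : (cube_set P `&` cube_set Q) x by []; rewrite h.
apply/andP; split.
  have /PsubQ/cube_setP/(_ i) : cube_set P P.1 by apply/cube_setP => j; lra.
  lra.
rewrite leNgt; apply/negP => lt.
have /cube_setP/(_ i) : cube_set P x by [].
move=> Pxi; have /cube_setP/(_ i) Qxi := Qx.
pose t := tnth Q.1 i + Q.2 - tnth P.1 i.
have : cube_set P [tuple tnth P.1 j + t | j < n].
  by apply/cube_setP => j; rewrite tnth_mktuple PQ /t; lra.
by move=> /PsubQ/cube_setP/(_ i); rewrite tnth_mktuple /t; lra.
Qed.

(** Let P be the cube of the next generation that contains the corner of the half cube.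
    If P were not aligned with Q in direction i, the cube P' of the same generation
    through the projection of the corner of P on the face of Q would meet P without
    being equal to it. *)
Lemma grid_subcube Q d : D Q -> D (subcube Q d).
Proof.
move=> DQ; have l0 := grid_side_gt0 DQ.
have [k sQ] : exists k : int, side Q = 2 ^ k by case: gridD => h _ _; exact: h.
have [P [DP sideP] Px] := generation_ex (k - 1) (subcube Q d).1.
have PQ : side P = side Q / 2 by rewrite sideP sQ half_exprz.
rewrite /side in PQ l0 *.
have Qx : cube_set Q (subcube Q d).1.
  by apply/cube_setP => j; rewrite tnth_mktuple; case: (d j); rewrite ?mul1r ?mul0r; lra.
suff -> : subcube Q d = P by [].
have H i := half_cube_corner i DP DQ PQ Px Qx.
have ends i : tnth P.1 i = tnth Q.1 i \/ tnth P.1 i = tnth Q.1 i + Q.2 / 2.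
  have := H i; rewrite /side => Hi.
  have [h1|h1|->] := ltgtP (tnth P.1 i) (tnth Q.1 i); [lra| |by left].
  have [h2|h2|->] := ltgtP (tnth P.1 i) (tnth Q.1 i + Q.2 / 2); [ |lra|by right].
  exfalso.
  pose y : Rn R n := [tuple if j == i then tnth Q.1 i else tnth P.1 j | j < n].
  have Qy : cube_set Q y.
    apply/cube_setP => j; rewrite tnth_mktuple; case: eqP => [->|_]; first lra.
    by have := H j; rewrite /side; lra.
  have [P' [DP' sP'] P'y] := generation_ex (k - 1) y.
  have P'Q : side P' = side Q / 2 by rewrite sP' sQ half_exprz.
  have := half_cube_corner i DP' DQ P'Q P'y Qy; rewrite /side => Hi'.
  have /cube_setP P'y' := P'y.
  have := P'y' i; rewrite tnth_mktuple eqxx => Hyi.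
  rewrite /side in P'Q.
  have PP' : P = P'.
    apply: (@generation_uniq (k - 1) _ _ P.1) => //.
      by apply/cube_setP => j; lra.
    apply/cube_setP => j; have := P'y' j; rewrite tnth_mktuple.
    by case: eqP => [->|_ //]; lra.
  by move: h1 Hyi; rewrite PP'; lra.
apply: (injective_projections (subcube Q d) P) => //=.
apply: eq_from_tnth => i; rewrite tnth_mktuple.
have /cube_setP/(_ i) := Px; rewrite tnth_mktuple.
by have := ends i; case: (d i); rewrite ?mul1r ?mul0r => -[]; lra.
Qed.

Definition grid_cube (k : int) x : cube R n :=
  xget ([tuple 0 | i < n], 1) [set Q | generation k Q /\ cube_set Q x].

Lemma grid_cubeP k x : generation k (grid_cube k x) /\ cube_set (grid_cube k x) x.
Proof.
apply: (@xgetPex _ _ [set Q | generation k Q /\ cube_set Q x]).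
by have [Q gQ Qx] := generation_ex k x; exists Q.
Qed.

Lemma grid_cube_eq k Q x : generation k Q -> cube_set Q x -> grid_cube k x = Q.
Proof.
by have [gP Px] := grid_cubeP k x => gQ Qx; exact: (generation_uniq gP gQ Px Qx).
Qed.

Lemma generation_subcube k Q d : generation k Q -> generation (k - 1) (subcube Q d).
Proof.
by move=> [DQ sQ]; split; [exact: grid_subcube|rewrite side_subcube sQ half_exprz].
Qed.

(** Each cube contains a point with rational coordinates, and disjoint cubes contain
    different ones. *)
Lemma generation_countable k : countable (generation k).
Proof.
have rat_point (Q : cube R n) : exists t : n.-tuple rat, generation k Q ->
    cube_set Q [tuple ratr (tnth t i) | i < n].
  have [gQ|] := pselect (generation k Q); last by exists [tuple 0 | i < n].
  have l0 : 0 < Q.2 by apply: grid_side_gt0; case: gQ.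
  have h (i : 'I_n) : {q : rat | tnth Q.1 i < ratr q < tnth Q.1 i + Q.2}.
    apply: cid; have [|q] := @rat_in_itvoo R (tnth Q.1 i) (tnth Q.1 i + Q.2).
      by rewrite ltrDl.
    by rewrite in_itv; exists q.
  exists [tuple sval (h i) | i < n] => _.
  apply/cube_setP => i; rewrite !tnth_mktuple; case: (h i) => q /= /andP[h1 h2].
  by rewrite ltW.
have [f fP] := choice rat_point.
apply/countable_injP; exists (fun Q => pickle (f Q)) => P Q.
rewrite !inE => gP gQ /(pcan_inj (@pickleK _)) PQ.
apply: (generation_uniq gP gQ (fP _ gP)); rewrite PQ; exact: fP.
Qed.

(** An enumeration of the cubes of one generation; empty cells fill the gaps in the
    numbering. *)
Lemma generation_cells k : exists c : nat -> set (Rn R n),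
  [/\ forall j, c j = set0 \/ exists2 Q, generation k Q & c j = cube_set Q,
      trivIset setT c & \bigcup_j c j = setT].
Proof.
have /countable_injP[f finj] := generation_countable k.
exists (fun j => [set x | f (grid_cube k x) = j]); split.
- move=> j; have [->|/set0P[x xj]] := eqVneq [set x | f (grid_cube k x) = j] set0.
    by left.
  right; have [gP Px] := grid_cubeP k x; exists (grid_cube k x) => //.
  rewrite -xj; apply/seteqP; split=> y /=.
    move=> /finj <-; rewrite ?inE //; first by case: (grid_cubeP k y).
    by case: (grid_cubeP k y).
  by move=> Py; rewrite (grid_cube_eq gP Py).
- by move=> i j _ _ [x [/= <- <-]].
- by rewrite -subTset => x _; exists (f (grid_cube k x)).
Qed.

Lemma measurable_cell k (c : nat -> set (Rn R n)) :
  (forall j, c j = set0 \/ exists2 Q, generation k Q & c j = cube_set Q) ->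
  forall j, measurable (c j).
Proof. by move=> h j; have [->|[Q _ ->]] := h j => //; exact: measurable_cube_set. Qed.

Lemma measurable_grid_cube k (F : cube R n -> R) :
  measurable_fun setT (fun x => F (grid_cube k x)).
Proof.
have [c [cP _ <-]] := generation_cells k.
apply/measurable_fun_bigcup; first exact: measurable_cell cP.
move=> j; have [->|[Q gQ ->]] := cP j; first exact: measurable_fun_set0.
apply: (@eq_measurable_fun _ _ _ _ _ (cst (F Q))) => //.
by move=> x; rewrite inE => Qx; rewrite (grid_cube_eq gQ Qx).
Qed.

Definition chain_sum (F : cube R n -> R) (k : int) (N : nat) x : R :=
  \sum_(j < N) F (grid_cube (k - j%:Z) x).

Lemma measurable_chain_sum F k N : measurable_fun setT (chain_sum F k N).
Proof. by apply: measurable_sum => j; exact: measurable_grid_cube. Qed.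

Lemma tree_sum_notin N (F : cube R n -> R) Q x : D Q -> ~ cube_set Q x ->
  tree_sum subcube N (fun P => F P * \1_(cube_set P) x) Q = 0.
Proof.
elim: N Q => [//|N IH] Q DQ Qx /=.
rewrite indicE memNset// mulr0 add0r big1// => d _.
apply: IH; first exact: grid_subcube.
by move=> /(cube_set_subcube (grid_side_gt0 DQ)).
Qed.

(** Among the descendants of Q exactly one in each generation contains x. *)
Lemma tree_sum_chain N (F : cube R n -> R) k Q x : generation k Q -> cube_set Q x ->
  tree_sum subcube N (fun P => F P * \1_(cube_set P) x) Q = chain_sum F k N x.
Proof.
elim: N k Q => [|N IH] k Q gQ Qx; first by rewrite /chain_sum big_ord0.
have [DQ _] := gQ; have l0 := grid_side_gt0 DQ.
rewrite /chain_sum big_ord_recl subr0 (grid_cube_eq gQ Qx) /=.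
rewrite indicE mem_set// mulr1 (bigD1 (subcube_index Q x))//=.
rewrite [X in _ + (_ + X)]big1 ?addr0; last first.
  move=> d dQ; apply: tree_sum_notin; first exact: grid_subcube.
  by move=> /(cube_set_subcubeE _ _ l0)[_ /eqP]; apply/negP.
rewrite (IH (k - 1)); [| exact: generation_subcube|exact/cube_set_subcubeE].
congr (_ + _); apply: eq_bigr => j _.
by congr (F (grid_cube _ x)); rewrite /= /bump/=; lia.
Qed.

Lemma le_integral_generation k (G H : Rn R n -> \bar R) (C : R) :
  (forall x, 0 <= G x)%E -> (forall x, 0 <= H x)%E -> 0 <= C ->
  measurable_fun setT G -> measurable_fun setT H ->
  (forall Q, generation k Q -> \int[leb]_(x in cube_set Q) G x <=
     C%:E * \int[leb]_(x in cube_set Q) H x)%E ->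
  (\int[leb]_x G x <= C%:E * \int[leb]_x H x)%E.
Proof.
move=> G0 H0 C0 mG mH GH; have [c [cP tc <-]] := generation_cells k.
have mc := measurable_cell cP.
rewrite !ge0_integral_bigcup//=; try by apply: measurable_funTS.
rewrite -nneseriesZl//; last by move=> j _; exact: integral_ge0.
apply: lee_nneseries => j; first by move=> *; apply: integral_ge0 => x _; exact: G0.
move=> _; have [->|[Q gQ ->]] := cP j; last exact: GH.
by rewrite !integral_set0 mule0.
Qed.
End grid_geometry.

Section grid_sums.
Context {R : realType} {n : nat}.
Hypothesis hn : (0 < n)%N.
Variable D : set (cube R n).
Hypothesis gridD : dyadic_grid D.
Implicit Types (Q : cube R n) (x : Rn R n) (F : cube R n -> R).

(** The cubes through x of the generations N, N - 1, ..., 1 - N; as N grows these exhaust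
    the cubes of the grid that contain x. *)
Definition level_sum F (N : nat) x : R := chain_sum D F N%:Z (N + N) x.

Lemma measurable_level_sum F N : measurable_fun setT (level_sum F N).
Proof. exact: measurable_chain_sum. Qed.

Lemma grid_cube_in (k : int) x : D (grid_cube D k x).
Proof. by have [[]] := grid_cubeP gridD k x. Qed.

Lemma level_sum_ge0 F N x : (forall Q, D Q -> 0 <= F Q) -> 0 <= level_sum F N x.
Proof. by move=> F0; apply: sumr_ge0 => j _; exact/F0/grid_cube_in. Qed.

Lemma level_sum_nondecreasing F x : (forall Q, D Q -> 0 <= F Q) ->
  {homo (level_sum F)^~ x : N M / (N <= M)%N >-> N <= M}.
Proof.
move=> F0; apply: homo_leq => //; first by move=> ? ? ?; exact: le_trans.
move=> N; rewrite /level_sum /chain_sum addSn addnS big_ord_recl big_ord_recr/=.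
rewrite [leLHS](_ : _ =
    \sum_(i < N + N) F (grid_cube D (N.+1%:Z - (lift ord0 i)%:Z) x)); last first.
  by apply: eq_bigr => i _; congr (F (grid_cube _ _ x)); rewrite /= /bump/=; lia.
rewrite addrCA lerDl addr_ge0//; exact/F0/grid_cube_in.
Qed.

Lemma esum_level_sum F x : (forall Q, D Q -> 0 <= F Q) ->
  \esum_(Q in D) (F Q * \1_(cube_set Q) x)%:E =
  ereal_sup (range (fun N => (level_sum F N x)%:E)).
Proof.
move=> F0; have F0' Q : D Q -> 0 <= F Q * \1_(cube_set Q) x.
  by move=> DQ; rewrite mulr_ge0 ?F0.
pose lev (N : nat) (j : nat) := grid_cube D (N%:Z - j%:Z) x.
pose U N := lev N @` `I_(N + N).
have finU N : finite_set (U N) by apply: finite_image; exact: finite_II.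
have UD N : U N `<=` D by move=> _ [j _ <-]; exact: grid_cube_in.
have levinj N : {in `I_(N + N) &, injective (lev N)}.
  move=> i j _ _ ij.
  have [[_ s1] _] := grid_cubeP gridD (N%:Z - i%:Z) x.
  have [[_ s2] _] := grid_cubeP gridD (N%:Z - j%:Z) x.
  have : 2 ^ (N%:Z - i%:Z) = 2 ^ (N%:Z - j%:Z) :> R by rewrite -s1 -s2 -/(lev N i) ij.
  by move=> /ieexprIz; rewrite ltr0n => /(_ isT); rewrite pnatr_eq1/= => /(_ isT); lia.
have sumU N : \sum_(Q \in U N) (F Q * \1_(cube_set Q) x)%:E = (level_sum F N x)%:E.
  rewrite (reindex_fsbig (lev N) `I_(N + N)); last first.
    by split; [move=> j jN; exists j|exact: levinj|move=> _ [j jN <-]; exists j].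
  rewrite -fsbig_ord sumEFin; congr EFin; apply: eq_bigr => j _.
  by rewrite indicE mem_set ?mulr1//; case: (grid_cubeP gridD (N%:Z - j%:Z) x).
apply/le_anti/andP; split; last first.
  apply: ge_ereal_sup => _ [N _ <-]; rewrite -sumU.
  by apply: esum_ge; exists (U N).
apply: ge_ereal_sup => _ [A [finA AD] <-].
have lvl Q : exists k : int, D Q -> side Q = 2 ^ k.
  have [DQ|nDQ] := pselect (D Q); last by exists 0.
  by case: gridD => h _ _; have [k ?] := h _ DQ; exists k.
have [k kP] := choice lvl.
have /finite_seqP[s As] := finA.
pose N := (\max_(Q <- s) `|k Q|.+1)%N.
have AN Q : A Q -> cube_set Q x -> U N Q.
  move=> AQ Qx; have DQ := AD _ AQ.
  have kN : (`|k Q|.+1 <= N)%N.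
    by apply: (@leq_bigmax_seq _ _ xpredT (fun Q => `|k Q|.+1)%N) => //; move: AQ; rewrite As.
  exists (`|(N%:Z - k Q)%R|%N) => /=; first by lia.
  apply: (grid_cube_eq gridD) => //; split=> //.
  by rewrite kP//; congr (2 ^ _); lia.
apply: (@le_trans _ _ (\sum_(Q \in U N) (F Q * \1_(cube_set Q) x)%:E)); last first.
  by rewrite sumU; apply: ereal_sup_ubound; exists N.
rewrite (@fsbigID _ _ _ _ (cube_set^~ x))//= [X in (_ + X)%E]fsbig1 ?adde0; last first.
  by move=> Q [_ Qx]; rewrite indicE memNset// mulr0.
apply: lee_fsum_nneg_subset => //.
- exact: finite_setIl.
- by move=> Q; rewrite !inE => -[]; exact: AN.
- by move=> Q /andP[_]; rewrite inE => /UD DQ; rewrite lee_fin F0'.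
Qed.

Lemma measurable_esum_grid F : (forall Q, D Q -> 0 <= F Q) ->
  measurable_fun setT (fun x => \esum_(Q in D) (F Q * \1_(cube_set Q) x)%:E).
Proof.
move=> F0; apply: (@emeasurable_fun_cvg _ _ _ _ (fun N x => (level_sum F N x)%:E)).
  by move=> N; apply/measurable_EFinP; exact: measurable_level_sum.
move=> x _; rewrite esum_level_sum//; apply: ereal_nondecreasing_cvgn => N M NM.
by rewrite lee_fin level_sum_nondecreasing.
Qed.
End grid_sums.

(** * Integrals over cubes *)

Section jensen.
Context {d : measure_display} {T : measurableType d} {R : realType}.
Variable mu : {measure set T -> \bar R}.

(** Integrate the tangent inequality for x^p at the mean value l of F with respect to
    the measure g mu. *)
Lemma jensen_density (E : set T) (p : R) (F g : T -> R) : 1 < p ->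
  measurable E -> measurable_fun E F -> measurable_fun E g ->
  (forall x, E x -> 0 <= F x) -> (forall x, E x -> 0 <= g x) ->
  mu.-integrable E (EFin \o g) -> mu.-integrable E (fun x => (F x `^ p * g x)%:E) ->
  0 < \int[mu]_(x in E) g x ->
  mu.-integrable E (fun x => (F x * g x)%:E) /\
  (\int[mu]_(x in E) g x) *
    ((\int[mu]_(x in E) (F x * g x)) / \int[mu]_(x in E) g x) `^ p <=
  \int[mu]_(x in E) (F x `^ p * g x).
Proof.
move=> p1 mE mF mg F0 g0 ig iFg I0.
have p0 : 0 < p by lra.
have iF : mu.-integrable E (fun x => (F x * g x)%:E).
  apply: (@le_integrable _ _ _ mu E mE _ ((EFin \o g) \+ (fun x => (F x `^ p * g x)%:E))%E) => //.
  - by apply/measurable_EFinP; exact: measurable_funM.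
  - move=> x Ex; rewrite /= lee_fin !ger0_norm ?addr_ge0 ?mulr_ge0 ?powR_ge0 ?F0 ?g0//.
    have := powR_tangent p1 (F0 x Ex) ltr01; rewrite !powR1 !mulr1 => h.
    have := g0 _ Ex => gx; rewrite -{2}[g x]mul1r -mulrDl ler_wpM2r//.
    have [F1|F1] := leP (F x) 1; first by rewrite (le_trans F1)// lerDl powR_ge0.
    have : 0 <= (p - 1) * (F x - 1) by rewrite mulr_ge0//; lra.
    by lra.
  - exact: integrableD.
split=> //; set I := \int[mu]_(x in E) g x in I0 *.
set J := \int[mu]_(x in E) (F x * g x).
have J0 : 0 <= J by apply: Rintegral_ge0 => x Ex; rewrite mulr_ge0 ?F0 ?g0.
have : 0 <= J / I by rewrite divr_ge0// ltW.
rewrite le_eqVlt => /predU1P[<-|l0].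
  rewrite powR0 ?gt_eqF// mulr0 Rintegral_ge0// => x Ex.
  by rewrite mulr_ge0 ?powR_ge0 ?g0.
set l := J / I in l0 *.
have iA : mu.-integrable E (EFin \o (fun x => p * l `^ (p - 1) * (F x * g x))).
  by apply: (integrableZl mE (p * l `^ (p - 1)) iF).
have iB : mu.-integrable E (EFin \o (fun x => (p - 1) * l `^ p * g x)).
  by apply: (integrableZl mE ((p - 1) * l `^ p) ig).
have iAB : mu.-integrable E (EFin \o
    (fun x => p * l `^ (p - 1) * (F x * g x) - (p - 1) * l `^ p * g x)).
  exact: (integrableB mE iA iB).
have pt x : E x ->
    p * l `^ (p - 1) * (F x * g x) - (p - 1) * l `^ p * g x <= F x `^ p * g x.
  move=> Ex; have := ler_wpM2r (g0 _ Ex) (powR_tangent p1 (F0 x Ex) l0).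
  by rewrite mulrBl mulrA.
have := le_Rintegral mE iAB iFg pt.
rewrite RintegralB// !RintegralZl// -/I -/J.
have -> : J = l * I by rewrite /l divfK// gt_eqF.
by rewrite -(mulr_powRB1 (ltW l0) p0); lra.
Qed.
End jensen.

Section density.
Context {d : measure_display} {T : measurableType d} {R : realType}.
Variable mu : {measure set T -> \bar R}.

Lemma Rintegral_gt0 (E : set T) (g : T -> R) : measurable E ->
  mu.-integrable E (EFin \o g) -> (forall x, E x -> 0 < g x) -> (0 < mu E)%E ->
  0 < \int[mu]_(x in E) g x.
Proof.
move=> mE ig g0 muE.
have I0 : (0 <= \int[mu]_(x in E) (g x)%:E)%E.
  by apply: integral_ge0 => x Ex; rewrite lee_fin ltW ?g0.
rewrite fine_gt0// lt_def I0 andbT (integrable_lty mE ig) andbT.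
apply/eqP => I.
have mg := measurable_int _ ig.
have /(ae_eq_integral_abs mu mE mg) : (\int[mu]_(x in E) `|(g x)%:E|)%E = 0%E.
  rewrite -[RHS]I; apply: eq_integral => x; rewrite inE => Ex.
  by rewrite gee0_abs// lee_fin ltW ?g0.
move=> [N [mN N0 EN]].
have : (mu E <= mu N)%E.
  apply: le_measure; rewrite ?inE// => x Ex; apply: EN => /= /(_ Ex)[].
  by move=> gx; have := g0 _ Ex; rewrite gx ltxx.
by rewrite N0 leNgt muE.
Qed.

Lemma Rintegral_bigcup_fin (I : finType) (E : set T) (F : I -> set T) (f : T -> R) :
  (forall i, measurable (F i)) -> trivIset setT F -> \bigcup_i F i = E ->
  mu.-integrable E (EFin \o f) ->
  \int[mu]_(x in E) f x = \sum_i \int[mu]_(x in F i) f x.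
Proof.
move=> mF tF FE if_.
have EE : \big[setU/set0]_(i <- index_enum I) F i = E.
  rewrite -FE; apply/seteqP; split=> x.
    by rewrite -bigcup_seq => -[i _ Fi]; exists i.
  by move=> [i _ Fi]; rewrite -bigcup_seq; exists i => //=; exact: mem_index_enum.
rewrite /Rintegral -EE integral_bigsetU_EFin//.
- rewrite sum_fine// => i _.
  apply: integrable_fin_num => //.
  apply: integrableS if_ => //; first by rewrite -EE; apply: bigsetU_measurable.
  by rewrite -FE => x Fx; exists i.
- exact: index_enum_uniq.
- exact: sub_trivIset tF.
- by rewrite EE; exact: measurable_int if_.
Qed.
End density.

Section change_of_density.
Import HBNNSimple.

Lemma ge0_integral_density (d : measure_display) (T : measurableType d)
    (R : realType) (mu nu : {measure set T -> \bar R}) (g : T -> R) (f : T -> \bar R) :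
  measurable_fun setT g -> (forall x, 0 <= g x) ->
  (forall A, measurable A -> nu A = (\int[mu]_(x in A) (g x)%:E)%E) ->
  measurable_fun setT f -> (forall x, 0 <= f x)%E ->
  (\int[nu]_x f x = \int[mu]_x (f x * (g x)%:E))%E.
Proof.
move=> mg g0 nuE mf f0; have mE := @measurableT _ T.
pose h := nnsfun_approx mE mf.
have mg' : measurable_fun setT (EFin \o g) by exact/measurable_EFinP.
have -> : (\int[nu]_x f x = lim (\int[nu]_x (EFin \o h n) x @[n --> \oo]))%E.
  have fE x : f x = lim ((EFin \o h n) x @[n --> \oo]).
    by apply/esym/cvg_lim => //; exact: cvg_nnsfun_approx.
  under eq_integral => x _ do rewrite fE.
  apply: monotone_convergence => //.
  - by move=> n; apply/measurable_EFinP.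
  - by move=> n x _ /=; rewrite lee_fin.
  - by move=> x _ a b ab; rewrite lee_fin; exact/lefP/nd_nnsfun_approx.
have -> : (\int[mu]_x (f x * (g x)%:E) =
    lim (\int[mu]_x ((h n x)%:E * (g x)%:E) @[n --> \oo]))%E.
  have fE x : (f x * (g x)%:E = lim (((h n x)%:E * (g x)%:E) @[n --> \oo]))%E.
    by apply/esym/cvg_lim => //; apply: cvgeZr => //; exact: cvg_nnsfun_approx.
  under eq_integral => x _ do rewrite fE.
  apply: monotone_convergence => //.
  - by move=> n; apply: emeasurable_funM => //; apply/measurable_EFinP.
  - by move=> n x _ /=; rewrite mule_ge0 ?lee_fin.
  - move=> x _ a b ab; rewrite lee_wpmul2r ?lee_fin//; exact/lefP/nd_nnsfun_approx.
suff suf n : (\int[mu]_x ((h n x)%:E * (g x)%:E) = \int[nu]_x (h n x)%:E)%E.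
  by congr (limn _); apply/funext => n; rewrite suf.
transitivity (\int[nu]_x
   (\sum_(y \in range (h n)) (y * \1_(h n @^-1` [set y]) x)%:E))%E; last first.
  by apply: eq_integral => t tE; rewrite /= fimfunE -fsumEFin.
have indich m r : measurable_fun setT (fun x => (r * \1_(h m @^-1` [set r]) x)%:E).
  by apply: (measurable_comp measurableT) => //; exact: measurable_funM.
rewrite ge0_integral_fsum//; last by move=> m y Ey; exact: nnfun_muleindic_ge0.
transitivity (\int[mu]_x (\sum_(y \in range (h n))
    (y * \1_(h n @^-1` [set y]) x)%:E * (g x)%:E))%E.
  under [RHS]eq_integral => x xE.
    rewrite -ge0_mule_fsuml => [|y]; last exact: nnfun_muleindic_ge0.
    rewrite fsumEFin // -(fimfunE _ x); over.
  by [].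
rewrite ge0_integral_fsum//; last 2 first.
- by move=> y; apply: emeasurable_funM.
- by move=> r y _; rewrite mule_ge0//; [exact: nnfun_muleindic_ge0|rewrite lee_fin].
apply: eq_fsbigr => r rhn.
have r0 : 0 <= r by move: rhn; rewrite inE => -[t _ <-].
under [RHS]eq_integral do rewrite EFinM.
rewrite integralZl_indic_nnsfun => //.
under eq_integral do rewrite EFinM -muleA.
rewrite ge0_integralZl//.
- under eq_integral do rewrite muleC.
  rewrite (eq_integral ((EFin \o g) \_ (h n @^-1` [set r]))); last first.
    by move=> x xE; rewrite epatch_indic.
  by rewrite -integral_mkcond integral_indic// setIT nuE.
- by apply: emeasurable_funM => //; exact/measurable_EFinP.
- by move=> t Et; rewrite mule_ge0 ?lee_fin.
Qed.
End change_of_density.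

Section cube_integrals.
Context {R : realType} {n : nat}.
Implicit Types (Q : cube R n) (F : Rn R n -> R).

Lemma loc_integrable_cube F Q : loc_integrable F ->
  leb.-integrable (cube_set Q) (EFin \o F).
Proof.
move=> [mF iF]; apply/integrableP; split.
  by apply/measurable_EFinP; exact: measurable_funTS.
pose K : set (Rn R n) := [set x | forall i, `[tnth Q.1 i, tnth Q.1 i + Q.2]%classic (tnth x i)].
have cK : compact [set (\row_i (tnth x i : R) : 'rV[R]_n) | x in K].
  rewrite (_ : image _ _ =
      [set v : 'rV[R]_n | forall i, `[tnth Q.1 i, tnth Q.1 i + Q.2]%classic (v ord0 i)]).
    apply: (@rV_compact R n (fun i => `[tnth Q.1 i : R, tnth Q.1 i + Q.2]%classic)).
    by move=> i; exact: segment_compact.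
  apply/seteqP; split=> [_ [x Kx <-] i|v Kv]; first by rewrite mxE; exact: Kx.
  exists [tuple v ord0 i | i < n]; first by move=> i; rewrite tnth_mktuple.
  by apply/rowP => i; rewrite mxE tnth_mktuple.
apply: le_lt_trans (iF K cK).
apply: ge0_subset_integral => //.
- exact: measurable_cube_set.
- rewrite (_ : K = \big[setI/setT]_(i < n)
     ((fun t : Rn R n => tnth t i) @^-1` `[tnth Q.1 i, tnth Q.1 i + Q.2]%classic)).
    apply: bigsetI_measurable => i _; rewrite -[X in measurable X]setTI.
    by apply: measurable_tnth => //; exact: measurable_itv.
  apply/seteqP; split=> t /=.
    by move=> h; elim/big_ind : _ => // i _; exact: h.
  by move=> h i; move: h; rewrite (bigD1 i)//= => -[].
- by apply: measurable_funTS; apply/measurable_EFinP; exact: measurableT_comp.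
- move=> x /cube_setP Qx i; have := Qx i; rewrite /= in_itv/=; lra.
Qed.

Lemma integrable_cst_cube Q c : 0 <= side Q ->
  leb.-integrable (cube_set Q) (EFin \o (fun=> c : R)).
Proof.
move=> Q0; apply/integrableP; split; first exact/measurable_EFinP.
rewrite [X in (X < _)%E](_ : _ = \int[leb]_(x in cube_set Q) cst `|c|%:E x)%E//.
rewrite integral_cst; last exact: measurable_cube_set.
by rewrite [X in (_ * X)%E](leb_cube_set Q0) -EFinM ltry.
Qed.

Lemma volumeE Q : 0 <= side Q -> volume Q = side Q ^+ n.
Proof. by move=> Q0; rewrite /volume leb_cube_set. Qed.

Lemma Rintegral_subcubes Q F : 0 < side Q ->
  leb.-integrable (cube_set Q) (EFin \o F) ->
  \int[leb]_(x in cube_set Q) F x =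
  \sum_d \int[leb]_(x in cube_set (subcube Q d)) F x.
Proof.
move=> Q0 iF; apply: Rintegral_bigcup_fin => //.
- by move=> d; exact: measurable_cube_set.
- move=> d d' _ _ [x []] /(cube_set_subcubeE _ _ Q0)[_ ->].
  by move=> /(cube_set_subcubeE _ _ Q0)[_ ->].
- apply/seteqP; split=> [x [d _]|x Qx]; first exact: cube_set_subcube.
  by exists (subcube_index Q x) => //; exact/cube_set_subcubeE.
Qed.

Lemma side_subcube_gt0 Q d : 0 < side Q -> 0 < side (subcube Q d).
Proof. by move=> Q0; rewrite side_subcube divr_gt0. Qed.

Lemma volume_gt0 Q : 0 < side Q -> 0 < volume Q.
Proof. by move=> Q0; rewrite volumeE ?ltW// exprn_gt0. Qed.

Lemma volume_subcube Q d : 0 < side Q -> volume Q = 2 ^+ n * volume (subcube Q d).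
Proof.
move=> Q0; rewrite !volumeE ?ltW ?side_subcube_gt0// side_subcube -exprMn.
by rewrite mulrC divfK.
Qed.

Lemma volume_subcubes Q : 0 < side Q -> volume Q = \sum_d volume (subcube Q d).
Proof.
move=> Q0.
rewrite (eq_bigr (fun=> volume Q / 2 ^+ n)); last first.
  by move=> d _; rewrite (volume_subcube d Q0) mulrC mulKf// expf_neq0.
rewrite sumr_const card_ffun card_bool card_ord -[RHS]mulr_natr natrX.
by rewrite divfK// expf_neq0.
Qed.

Lemma fine_avg Q F : 0 < side Q ->
  leb.-integrable (cube_set Q) (EFin \o F) ->
  fine (avg Q F) = (\int[leb]_(x in cube_set Q) F x) / volume Q.
Proof.
move=> Q0 iF; rewrite /avg fineM//; last first.
  by apply: integrable_fin_num => //; exact: measurable_cube_set.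
by rewrite mulrC.
Qed.

Lemma avgE Q F : 0 < side Q ->
  leb.-integrable (cube_set Q) (EFin \o F) ->
  avg Q F = ((\int[leb]_(x in cube_set Q) F x) / volume Q)%:E.
Proof.
move=> Q0 iF; rewrite -fine_avg// fineK// /avg fin_numM//.
by apply: integrable_fin_num => //; exact: measurable_cube_set.
Qed.
End cube_integrals.

(** * Haar coefficients and the Carleson condition *)

Section haar_coefficients.
Context {R : realType} {n : nat}.
Implicit Types (Q : cube R n) (e d : {ffun 'I_n -> bool}).

(** The constant value, up to normalisation, of the Haar function of type e on the half
    cube d. *)
Definition haar_sign e d : R := \prod_(i < n) (if e i then 1 else (-1) ^+ ~~ d i).

Lemma haar_sign_sqr e d : haar_sign e d ^+ 2 = 1.
Proof.
rewrite /haar_sign -prodrXl big1// => i _.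
by case: (e i); rewrite ?expr1n// -exprM mulnC exprM sqrrN expr1n expr1n.
Qed.

(** The sum over d factors over the coordinates, and the factor of a coordinate in which
    the Haar function is cancellative vanishes. *)
Lemma sum_haar_sign e : e != [ffun=> true] -> \sum_d haar_sign e d = 0.
Proof.
move=> e1; have [i ei] : exists i, e i = false.
  apply: contrapT => h; move/eqP : e1; apply; apply/ffunP => i; rewrite ffunE.
  by apply/negPn/negP => /negbTE ei; apply: h; exists i.
rewrite /haar_sign -(bigA_distr_bigA (fun i b => (if e i then 1 else (-1) ^+ ~~ b) : R)).
by rewrite (bigD1 i)//= ei big_bool /= expr0 expr1 addrN mul0r.
Qed.

Lemma haar_subcube Q e d x : 0 < side Q -> cube_set (subcube Q d) x ->
  haar Q e x = (Num.sqrt (side Q))^-1 ^+ n * haar_sign e d.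
Proof.
move=> Q0 Px; rewrite /haar /haar1 big_split/= prodr_const card_ord.
congr (_ * _); apply: eq_bigr => i _.
rewrite /side in Q0 *.
have /cube_setP/(_ i) := Px; rewrite tnth_mktuple /= !indicE => Pxi.
case: (e i); first by rewrite mem_set//= in_itv/=; move: Pxi;
    case: (d i); rewrite ?mul1r ?mul0r; lra.
move: Pxi; case: (d i); rewrite ?mul1r ?mul0r => Pxi.
  by rewrite mem_set ?memNset ?subr0//= in_itv/=; lra.
by rewrite memNset ?mem_set ?sub0r//= in_itv/=; lra.
Qed.

Lemma haar_out Q e x : 0 < side Q -> ~ cube_set Q x -> haar Q e x = 0.
Proof.
rewrite /side => Q0 Qx.
have [i xi] : exists i, ~ edge Q i (tnth x i) by apply/existsNP.
rewrite /haar (bigD1 i)//= /haar1 /side.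
move: xi; rewrite /edge /= in_itv/= => xi.
case: (e i); rewrite !indicE !memNset ?subr0 ?mulr0 ?mul0r//= in_itv/= => ?;
  by apply: xi; lra.
Qed.

Lemma haarE Q e x : 0 < side Q -> haar Q e x =
  \sum_d (Num.sqrt (side Q))^-1 ^+ n * haar_sign e d * \1_(cube_set (subcube Q d)) x.
Proof.
move=> Q0; have [Qx|Qx] := pselect (cube_set Q x); last first.
  rewrite haar_out// big1// => d _; rewrite indicE memNset ?mulr0//.
  by move=> /(cube_set_subcube Q0).
have Px : cube_set (subcube Q (subcube_index Q x)) x by apply/cube_set_subcubeE.
rewrite (haar_subcube e Q0 Px) (bigD1 (subcube_index Q x))//= indicE mem_set// mulr1.
rewrite big1 ?addr0// => d dx; rewrite indicE memNset ?mulr0//.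
by move=> /(cube_set_subcubeE _ _ Q0)[_ /eqP]; apply/negP.
Qed.

Lemma measurable_haar Q e : 0 < side Q -> measurable_fun setT (haar Q e).
Proof.
move=> Q0; rewrite (_ : haar Q e = fun x => \sum_d (Num.sqrt (side Q))^-1 ^+ n *
  haar_sign e d * \1_(cube_set (subcube Q d)) x); last first.
  by apply/funext => x; exact: haarE.
apply: measurable_sum => d; apply: measurable_funM => //.
by apply: measurable_indic => //; exact: measurable_cube_set.
Qed.

Lemma pairing_haarE (a : Rn R n -> R) Q e : 0 < side Q ->
  leb.-integrable (cube_set Q) (EFin \o a) ->
  pairing a (haar Q e) = (Num.sqrt (side Q))^-1 ^+ n *
    \sum_d haar_sign e d * \int[leb]_(x in cube_set (subcube Q d)) a x.
Proof.
move=> Q0 ia; set c := _ ^+ n.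
have c0 : 0 <= c by rewrite exprn_ge0// invr_ge0 sqrtr_ge0.
have mQ := measurable_cube_set Q.
have ma := measurable_int _ ia; move/measurable_EFinP : (ma) => ma'.
rewrite /pairing (_ : (fun x => a x * haar Q e x) =
    (fun x => a x * haar Q e x) \_ (cube_set Q)); last first.
  apply/funext => x; rewrite patchE; case: ifPn => // /negP; rewrite inE => Qx.
  by rewrite haar_out// mulr0.
rewrite -Rintegral_mkcond Rintegral_subcubes//.
  rewrite mulr_sumr; apply: eq_bigr => d _.
  rewrite mulrA -RintegralZl.
  - apply: eq_Rintegral => x; rewrite inE => Px.
    by rewrite (haar_subcube e Q0 Px) mulrC.
  - exact: measurable_cube_set.
  - apply: integrableS ia => //; first exact: measurable_cube_set.
    exact: cube_set_subcube.
apply: (@le_integrable _ _ _ _ _ mQ _ (EFin \o (fun x => c * a x))) => //.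
- apply/measurable_EFinP; apply: measurable_funM => //.
  by apply: measurable_funTS; exact: measurable_haar.
- move=> x Qx; rewrite /= lee_fin.
  have Px : cube_set (subcube Q (subcube_index Q x)) x by apply/cube_set_subcubeE.
  rewrite (haar_subcube e Q0 Px) !normrM mulrC -/c.
  rewrite [X in _ * X * _](_ : _ = 1) ?mulr1//.
  by apply/eqP; rewrite -(@eqrXn2 _ 2)// real_normK ?num_real// haar_sign_sqr expr1n.
- exact: (integrableZl mQ c ia).
Qed.

Definition integral_jump (a : Rn R n -> R) : cube R n -> R :=
  square_jump subcube volume (fun P => \int[leb]_(x in cube_set P) a x).

(** By cancellation the averages over the half cubes may be recentred at the average over
    Q; the rest is the Cauchy-Schwarz inequality. *)
Lemma pairing_haar_sqr (a : Rn R n -> R) Q e : 0 < side Q ->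
  leb.-integrable (cube_set Q) (EFin \o a) -> e != [ffun=> true] ->
  pairing a (haar Q e) ^+ 2 <= integral_jump a Q.
Proof.
move=> Q0 ia e1; rewrite pairing_haarE// /integral_jump /square_jump.
set A := fun P => \int[leb]_(x in cube_set P) a x.
have m0 d : 0 < volume (subcube Q d) by rewrite volume_gt0 ?side_subcube_gt0.
pose y d := haar_sign e d * (A (subcube Q d) / volume (subcube Q d) - A Q / volume Q).
rewrite (_ : \sum_d haar_sign e d * _ = \sum_d volume (subcube Q d) * y d); last first.
  apply/eqP; rewrite -subr_eq0 -sumrB.
  rewrite (eq_bigr (fun d => A Q / volume Q * (volume Q / 2 ^+ n) * haar_sign e d)).
    by rewrite -mulr_sumr sum_haar_sign// mulr0.
  move=> d _; rewrite /y.
  have -> : volume Q / 2 ^+ n = volume (subcube Q d).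
    by rewrite (volume_subcube d Q0) mulrC mulKf// expf_neq0.
  rewrite -/(A (subcube Q d)); have := m0 d; set v := volume (subcube Q d) => v0.
  by field; rewrite !gt_eqF// volume_gt0.
rewrite exprMn.
have := sqr_sum_le y (fun d => ltW (m0 d)); rewrite -volume_subcubes//.
rewrite [X in _ <= _ * X -> _](eq_bigr (fun d => volume (subcube Q d) *
  (A (subcube Q d) / volume (subcube Q d) - A Q / volume Q) ^+ 2)); last first.
  by move=> d _; rewrite /y exprMn haar_sign_sqr mul1r.
have c2 : ((Num.sqrt (side Q))^-1 ^+ n) ^+ 2 = (volume Q)^-1.
  rewrite -exprM mulnC exprM exprVn sqr_sqrtr ?ltW//.
  by rewrite exprVn volumeE// ltW.
by rewrite c2 => h; rewrite mulrC ler_pdivrMr ?volume_gt0// mulrC.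
Qed.
End haar_coefficients.

Definition carleson_constant (R : realType) (n : nat) : R :=
  2 ^+ n * (4 + 4 * (2 ^+ n) ^+ 2).

Lemma carleson_constant_ge0 (R : realType) (n : nat) : 0 <= carleson_constant R n.
Proof. by rewrite mulr_ge0// ?exprn_ge0// addr_ge0// mulr_ge0// sqr_ge0. Qed.

Section bmo_carleson.
Context {R : realType} {n : nat}.
Hypothesis hn : (0 < n)%N.
Variable D : set (cube R n).
Hypothesis gridD : dyadic_grid D.
Implicit Types (Q : cube R n) (a b : Rn R n -> R).

Definition haar_product a b Q : R :=
  \sum_(e : {ffun 'I_n -> bool} | e != [ffun=> true])
    `|pairing a (haar Q e)| * `|pairing b (haar Q e)|.

Lemma integrable_normr (E : set (Rn R n)) (f : Rn R n -> R) :
  leb.-integrable E (EFin \o f) -> leb.-integrable E (EFin \o (fun x => `|f x|)).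
Proof. exact: integrable_abse. Qed.

Lemma bmo_norm_ge0 a : (0 <= bmo_norm D a)%E.
Proof.
have [[DQ _] _] := grid_cubeP gridD 0 [tuple 0 | i < n].
apply: le_trans (ereal_sup_ubound _) => /=; last by eexists; [exact: DQ|reflexivity].
rewrite /avg mule_ge0 ?lee_fin ?invr_ge0 ?fine_ge0//.
by apply: integral_ge0 => x _; rewrite lee_fin.
Qed.

Lemma bmo_norm_fin a : bmo D a -> (fine (bmo_norm D a))%:E = bmo_norm D a.
Proof. by case=> _ h; rewrite fineK// ge0_fin_numE// bmo_norm_ge0. Qed.

Lemma square_jump_bmo a N Q : bmo D a -> D Q ->
  tree_sum subcube N (integral_jump a) Q <=
  (4 + 4 * (2 ^+ n) ^+ 2) * fine (bmo_norm D a) ^+ 2 * volume Q.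
Proof.
move=> bmoa DQ; have [la _] := bmoa.
have pos P : D P -> 0 < side P by exact: grid_side_gt0.
have ia P := loc_integrable_cube P la.
have ic c P : D P -> leb.-integrable (cube_set P) (EFin \o (fun x => a x - c)).
  move=> DP; exact: (integrableB (measurable_cube_set P) (ia P)
    (integrable_cst_cube c (ltW (pos _ DP)))).
have iabs c P : D P -> leb.-integrable (cube_set P) (EFin \o (fun x => `|a x - c|)).
  by move=> DP; exact/integrable_normr/ic.
have sub P d : D P -> D (subcube P d) by move=> DP; exact: grid_subcube.
apply: (square_jump_carleson sub
    (V := fun c P => \int[leb]_(x in cube_set P) `|a x - c|)) => //.
- by move=> P DP; apply: volume_subcubes; exact: pos.
- by move=> P DP; apply: Rintegral_subcubes; [exact: pos|exact: ia].
- by move=> c P DP; apply: Rintegral_subcubes; [exact: pos|exact: iabs].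
- by move=> P DP; apply: volume_gt0; exact: pos.
- by rewrite fine_ge0// bmo_norm_ge0.
- by move=> P d DP; rewrite (volume_subcube d (pos _ DP)).
- move=> c P DP; have mP := measurable_cube_set P.
  rewrite (_ : _ - _ = \int[leb]_(x in cube_set P) (a x - c)).
    exact: le_normr_Rintegral (ic c P DP).
  rewrite RintegralB//; last exact: (integrable_cst_cube c (ltW (pos _ DP))).
  by rewrite Rintegral_cst.
- move=> P DP; rewrite -ler_pdivrMr ?volume_gt0 ?pos//.
  rewrite -(fine_avg (pos _ DP) (ia P)) -(fine_avg (pos _ DP) (iabs _ _ DP)).
  rewrite fine_le//.
  + by rewrite avgE ?pos//; exact: iabs.
  + by rewrite -bmo_norm_fin.
  + by apply: ereal_sup_ubound; exists P.
Qed.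

Lemma haar_product_ge0 a b Q : 0 <= haar_product a b Q.
Proof. by apply: sumr_ge0 => e _; rewrite mulr_ge0. Qed.

(** Each product of coefficients is split by the arithmetic-geometric mean inequality
    with ratio Mb / Ma, and there are at most 2^n of them for each cube. *)
Lemma haar_product_carleson_of_jump a b (k Ma Mb : R) N Q :
  loc_integrable a -> loc_integrable b -> 0 <= Ma -> 0 <= Mb ->
  (forall N P, D P -> tree_sum subcube N (integral_jump a) P <= k * Ma ^+ 2 * volume P) ->
  (forall N P, D P -> tree_sum subcube N (integral_jump b) P <= k * Mb ^+ 2 * volume P) ->
  D Q ->
  tree_sum subcube N (haar_product a b) Q <= 2 ^+ n * k * (Ma * Mb) * volume Q.
Proof.
move=> la lb Ma0 Mb0 jump_a jump_b DQ.
have sub P d : D P -> D (subcube P d) by move=> DP; exact: grid_subcube.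
have pos P : D P -> 0 < side P by exact: grid_side_gt0.
have Jle a' e P : loc_integrable a' -> D P -> e != [ffun=> true] ->
    `|pairing a' (haar P e)| ^+ 2 <= integral_jump a' P.
  move=> la' DP e1; rewrite real_normK ?num_real//.
  by apply: pairing_haar_sqr; [exact: pos|exact: loc_integrable_cube|].
have zero a' : loc_integrable a' ->
    (forall N P, D P -> tree_sum subcube N (integral_jump a') P <= k * 0 ^+ 2 * volume P) ->
    forall P e, D P -> e != [ffun=> true] -> `|pairing a' (haar P e)| = 0.
  move=> la' h P e DP e1; apply/eqP; rewrite -sqrf_eq0 eq_le sqr_ge0 andbT.
  apply: (le_trans (Jle _ _ _ la' DP e1)).
  by have := h 1%N _ DP; rewrite /= big1// addr0 expr0n/= mulr0 mul0r.
have zero' : (forall P, D P -> haar_product a b P <= 0) ->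
    tree_sum subcube N (haar_product a b) Q <= 0.
  move=> h; apply: (@le_trans _ _ (tree_sum subcube N (fun P => 0 * haar_product a b P) Q)).
    by apply: (ler_tree_sum sub) => // P DP; rewrite mul0r h.
  by rewrite tree_sumZ mul0r.
(* If Ma or Mb vanishes, so do all the coefficients of that function. *)
move: Ma0; rewrite le_eqVlt => /predU1P[az|Ma0].
  rewrite -az in jump_a *; rewrite [leRHS](_ : _ = 0); last by rewrite mul0r mulr0 mul0r.
  apply: zero' => P DP; rewrite /haar_product big1// => e e1.
  by rewrite (zero _ la jump_a _ _ DP e1) mul0r.
move: Mb0; rewrite le_eqVlt => /predU1P[bz|Mb0].
  rewrite -bz in jump_b *; rewrite [leRHS](_ : _ = 0); last by rewrite !mulr0 mul0r.
  apply: zero' => P DP; rewrite /haar_product big1// => e e1.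
  by rewrite (zero _ lb jump_b _ _ DP e1) mulr0.
apply: (@le_trans _ _ (tree_sum subcube N
   (fun P => 2 ^+ n * ((Mb / Ma / 2) * integral_jump a P + (Ma / Mb / 2) * integral_jump b P)) Q)).
  apply: (ler_tree_sum sub) => // P DP.
  apply: (@le_trans _ _ (\sum_(e : {ffun 'I_n -> bool})
     ((Mb / Ma / 2) * integral_jump a P + (Ma / Mb / 2) * integral_jump b P))); last first.
    by rewrite sumr_const card_ffun card_bool card_ord -[leLHS]mulr_natr natrX mulrC.
  have t0 : 0 < Mb / Ma by rewrite divr_gt0.
  have s0 : 0 < Ma / Mb by rewrite divr_gt0.
  have nonneg : 0 <= (Mb / Ma / 2) * integral_jump a P + (Ma / Mb / 2) * integral_jump b P.
    have J0 a' : 0 <= integral_jump a' P.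
      apply: sumr_ge0 => d _; rewrite mulr_ge0 ?sqr_ge0// ltW// volume_gt0//.
      by rewrite side_subcube_gt0 ?pos.
    by rewrite addr_ge0// mulr_ge0// ltW// divr_gt0.
  rewrite /haar_product big_mkcond/=; apply: ler_sum => e _.
  case: ifPn => // e1.
  exact: weighted_amgm Ma0 Mb0 (Jle _ _ _ la DP e1) (Jle _ _ _ lb DP e1).
rewrite tree_sumZ tree_sumD !tree_sumZ.
rewrite [leRHS](_ : _ = 2 ^+ n * (k * (Ma * Mb) * volume Q)); last by ring.
rewrite ler_wpM2l ?exprn_ge0//.
have ha := jump_a N _ DQ; have hb := jump_b N _ DQ.
have t0 : 0 <= Mb / Ma / 2 by rewrite ltW// !divr_gt0.
have s0 : 0 <= Ma / Mb / 2 by rewrite ltW// !divr_gt0.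
have h1 := ler_wpM2l t0 ha; have h2 := ler_wpM2l s0 hb.
apply: (le_trans (lerD h1 h2)); rewrite le_eqVlt; apply/orP; left; apply/eqP.
by field; rewrite !gt_eqF.
Qed.

Lemma haar_product_carleson a b N Q : bmo D a -> bmo D b -> D Q ->
  tree_sum subcube N (haar_product a b) Q <=
  carleson_constant R n * (fine (bmo_norm D a) * fine (bmo_norm D b)) * volume Q.
Proof.
move=> ba bb; apply: haar_product_carleson_of_jump.
- by case: ba.
- by case: bb.
- by rewrite fine_ge0// bmo_norm_ge0.
- by rewrite fine_ge0// bmo_norm_ge0.
- by move=> M P; exact: square_jump_bmo.
- by move=> M P; exact: square_jump_bmo.
Qed.
End bmo_carleson.

(** * The weighted estimate below one cube *)

Section localized_sums.
Context {R : realType} {n : nat}.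
Hypothesis hn : (0 < n)%N.
Variable D : set (cube R n).
Hypothesis gridD : dyadic_grid D.
Implicit Types (Q : cube R n) (x : Rn R n).
Variable t : cube R n -> R.
Hypothesis t0 : forall Q, D Q -> 0 <= t Q.

(** The part of sum_Q t_Q 1_Q that comes from N generations of cubes below Q. *)
Definition localized_sum (N : nat) Q x : R :=
  tree_sum subcube N (fun P => t P * \1_(cube_set P) x) Q.

Let sub Q d : D Q -> D (subcube Q d).
Proof. by move=> DQ; exact: grid_subcube. Qed.

Let pos Q : D Q -> 0 < side Q.
Proof. exact: grid_side_gt0. Qed.

Lemma localized_sum_ge0 N Q x : D Q -> 0 <= localized_sum N Q x.
Proof. by move=> DQ; apply: (tree_sum_ge0 sub) => // P DP; rewrite mulr_ge0 ?t0. Qed.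

Lemma localized_sum_le N Q x : D Q -> localized_sum N Q x <= tree_sum subcube N t Q.
Proof.
move=> DQ; apply: (ler_tree_sum sub) => // P DP.
by rewrite ler_piMr ?t0// indicE; case: (_ \in _).
Qed.

Lemma measurable_localized_sum N Q : measurable_fun setT (localized_sum N Q).
Proof.
rewrite /localized_sum; elim: N Q => [|N IH] Q /=; first exact: measurable_cst.
apply: measurable_funD; last by apply: measurable_sum => d; exact: IH.
apply: measurable_funM => //; apply: measurable_indic => //.
exact: measurable_cube_set.
Qed.

Lemma localized_sum_subcube N Q d x : D Q -> cube_set (subcube Q d) x ->
  localized_sum N.+1 Q x = t Q + localized_sum N (subcube Q d) x.
Proof.
move=> DQ Px; have /(cube_set_subcubeE _ _ (pos DQ))[Qx dE] := Px.
rewrite /localized_sum /= indicE mem_set// mulr1 (bigD1 d)//= big1 ?addr0// => d' dd'.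
apply: (tree_sum_notin hn gridD); first exact: sub.
move=> /(cube_set_subcubeE _ _ (pos DQ))[_ d'E].
by move: dd'; rewrite d'E dE eqxx.
Qed.

Lemma integrable_localized_sumM N Q (E : set (Rn R n)) (g : Rn R n -> R) : D Q ->
  measurable E -> leb.-integrable E (EFin \o g) ->
  leb.-integrable E (EFin \o (fun x => localized_sum N Q x * g x)).
Proof.
move=> DQ mE ig.
have mg : measurable_fun E g by apply/measurable_EFinP; exact: measurable_int ig.
pose B := tree_sum subcube N t Q.
have B0 : 0 <= B by exact: (tree_sum_ge0 sub).
apply: (@le_integrable _ _ _ _ _ mE _ (EFin \o (fun x => B * g x))).
- apply/measurable_EFinP; apply: measurable_funM => //.
  by apply: measurable_funTS; exact: measurable_localized_sum.
- move=> x _; rewrite /= lee_fin !normrM ler_wpM2r//.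
  by rewrite !ger0_norm ?localized_sum_ge0// localized_sum_le.
- exact: (integrableZl mE B ig).
Qed.

(** This turns the duality pairing of a localized sum with g into a sum over the tree. *)
Lemma Rintegral_localized_sum N Q (g : Rn R n -> R) : D Q ->
  leb.-integrable (cube_set Q) (EFin \o g) ->
  \int[leb]_(x in cube_set Q) (localized_sum N Q x * g x) =
  tree_sum subcube N (fun P => t P * \int[leb]_(x in cube_set P) g x) Q.
Proof.
elim: N Q => [|N IH] Q DQ ig.
  rewrite /localized_sum /=; under eq_Rintegral do rewrite mul0r.
  by rewrite Rintegral_cst ?mul0r//; exact: measurable_cube_set.
have igd d : leb.-integrable (cube_set (subcube Q d)) (EFin \o g).
  apply: integrableS ig => //; [exact: measurable_cube_set.. |].
  exact: cube_set_subcube (pos DQ).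
rewrite (Rintegral_subcubes (pos DQ)); last first.
  by apply: integrable_localized_sumM => //; exact: measurable_cube_set.
rewrite [RHS]/= (Rintegral_subcubes (pos DQ) ig) mulr_sumr -big_split/=.
apply: eq_bigr => d _; have mP := measurable_cube_set (subcube Q d).
rewrite -(IH _ (sub d DQ) (igd d)) -RintegralZl// -RintegralD//; last 2 first.
- exact: (integrableZl mP (t Q) (igd d)).
- by apply: integrable_localized_sumM => //; exact: sub.
apply: eq_Rintegral => x; rewrite inE => Px.
by rewrite (localized_sum_subcube N DQ Px) mulrDl.
Qed.
End localized_sums.

Section cube_jensen.
Context {R : realType} {n : nat}.
Implicit Types (Q : cube R n) (x : Rn R n).

Definition mass (g : Rn R n -> R) Q : R := \int[leb]_(x in cube_set Q) g x.

Lemma mass_gt0 (g : Rn R n -> R) Q : 0 < side Q -> (forall x, 0 < g x) ->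
  leb.-integrable (cube_set Q) (EFin \o g) -> 0 < mass g Q.
Proof.
move=> Q0 g0 ig; apply: Rintegral_gt0 => //; first exact: measurable_cube_set.
by rewrite [X in (_ < X)%E](leb_cube_set (ltW Q0)) lte_fin exprn_gt0.
Qed.

Lemma measurable_powR_comp (r : R) (g : Rn R n -> R) : measurable_fun setT g ->
  measurable_fun setT (fun x => g x `^ r).
Proof. by move=> mg; exact: (measurableT_comp (measurable_powR _) mg). Qed.

(** Here H stands for F g and G for F^p g. *)
Lemma cube_jensen (p : R) (F g H G : Rn R n -> R) Q : 1 < p -> 0 < side Q ->
  measurable_fun setT F -> measurable_fun setT g ->
  (forall x, 0 <= F x) -> (forall x, 0 < g x) ->
  (forall x, F x * g x = H x) -> (forall x, F x `^ p * g x = G x) ->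
  leb.-integrable (cube_set Q) (EFin \o g) ->
  leb.-integrable (cube_set Q) (EFin \o G) ->
  leb.-integrable (cube_set Q) (EFin \o H) /\
  mass g Q * (mass H Q / mass g Q) `^ p <= mass G Q.
Proof.
move=> p1 Q0 mF mg F0 g0 FH FG ig iG.
have <- : (fun x => F x * g x) = H by apply/funext.
have GE : (fun x => F x `^ p * g x) = G by apply/funext.
rewrite -GE in iG *; apply: jensen_density => //.
- exact: measurable_cube_set.
- exact: measurable_funTS.
- exact: measurable_funTS.
- by move=> x _; exact: ltW.
- exact: mass_gt0.
Qed.

Lemma mass1 Q : 0 <= side Q -> mass (fun=> 1) Q = volume Q.
Proof. by move=> Q0; rewrite /mass Rintegral_cst ?mul1r//; exact: measurable_cube_set. Qed.

Lemma mass_subcubes (g : Rn R n -> R) Q : 0 < side Q ->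
  leb.-integrable (cube_set Q) (EFin \o g) -> mass g Q = \sum_d mass g (subcube Q d).
Proof. exact: Rintegral_subcubes. Qed.
End cube_jensen.

Section weighted_bound.
Context {R : realType} {n : nat}.
Hypothesis hn : (0 < n)%N.
Variable D : set (cube R n).
Hypothesis gridD : dyadic_grid D.
Implicit Types (Q : cube R n) (x : Rn R n).
Variables (p A k : R) (v f : Rn R n -> R) (alpha : cube R n -> R).
Hypothesis p1 : 1 < p.
Hypothesis v0 : forall x, 0 < v x.
Hypothesis mv : measurable_fun setT v.
Definition dual_density x : R := v x `^ (- (p - 1)^-1).
Local Notation sigma := dual_density.
Hypothesis iv : forall Q, 0 < side Q -> leb.-integrable (cube_set Q) (EFin \o v).
Hypothesis isg : forall Q, 0 < side Q -> leb.-integrable (cube_set Q) (EFin \o sigma).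
Hypothesis Ap : forall Q, 0 < side Q ->
  mass v Q / volume Q * (mass sigma Q / volume Q) `^ (p - 1) <= A.
Hypothesis mf : measurable_fun setT f.
Hypothesis ifv : forall Q, 0 < side Q ->
  leb.-integrable (cube_set Q) (EFin \o (fun x => `|f x| `^ p * v x)).
Hypothesis alpha0 : forall Q, D Q -> 0 <= alpha Q.
Hypothesis k0 : 0 <= k.
Hypothesis car : forall N Q, D Q -> tree_sum subcube N alpha Q <= k * volume Q.

Let sigma0 x : 0 < sigma x. Proof. exact: powR_gt0. Qed.

Let msigma : measurable_fun setT sigma.
Proof. exact: measurable_powR_comp. Qed.

Lemma cube_integrable_abs Q : 0 < side Q ->
  leb.-integrable (cube_set Q) (EFin \o (fun x => `|f x|)) /\
  mass sigma Q * (mass (fun x => `|f x|) Q / mass sigma Q) `^ p <=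
  mass (fun x => `|f x| `^ p * v x) Q.
Proof.
move=> Q0; apply: (@cube_jensen _ _ p (fun x => `|f x| * (sigma x)^-1) sigma) => //.
- apply: measurable_funM; first exact: measurableT_comp.
  rewrite (_ : (fun x => _) = (fun x => v x `^ ((p - 1)^-1))).
    exact: measurable_powR_comp.
  by apply/funext => x; rewrite /sigma powRN invrK.
- by move=> x; rewrite mulr_ge0// invr_ge0 ltW.
- by move=> x; rewrite divfK// gt_eqF.
- move=> x; rewrite powRM ?invr_ge0 ?(ltW (sigma0 x))// -mulrA; congr (_ * _).
  rewrite -(powR_inv1 (ltW (sigma0 x))) -powRrM mulN1r.
  rewrite -[X in _ * X](powRr1 (ltW (sigma0 x))) -powRD; last first.
    by rewrite [sigma x == 0]gt_eqF// implybT.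
  rewrite -powRrM (_ : _ * _ = 1) ?powRr1 ?(ltW (v0 x))//.
  by have := p1 => p1'; field; lra.
- exact: isg.
- exact: ifv.
Qed.

Lemma cube_sqrt_jensen (g : Rn R n -> R) Q : 0 < side Q -> (forall x, 0 < g x) ->
  measurable_fun setT g -> leb.-integrable (cube_set Q) (EFin \o g) ->
  leb.-integrable (cube_set Q) (EFin \o (fun x => g x `^ 2^-1)) /\
  volume Q * (mass (fun x => g x `^ 2^-1) Q / volume Q) `^ 2 <= mass g Q.
Proof.
move=> Q0 g0 mg ig; rewrite -(mass1 (ltW Q0)).
apply: (@cube_jensen _ _ 2 (fun x => g x `^ 2^-1)) => //.
- by rewrite ltr1n.
- exact: measurable_powR_comp.
- by move=> x; exact: powR_ge0.
- by move=> x; rewrite mulr1.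
- by move=> x; rewrite mulr1 -powRrM mulVf// powRr1// ltW.
- exact: (integrable_cst_cube 1 (ltW Q0)).
Qed.

(** Jensen's inequality for the function sigma^(-1/2) and the density sigma^(1/2): the
    product is 1, and sigma^((1-p)/2) = v^(1/2). *)
Lemma cube_duality Q : 0 < side Q ->
  1 <= ((mass (fun x => sigma x `^ 2^-1) Q / volume Q) `^ 2) `^ (p - 1) *
    (mass (fun x => v x `^ 2^-1) Q / volume Q) `^ 2.
Proof.
move=> Q0; have p1r := p1.
have [is2 _] := cube_sqrt_jensen Q0 sigma0 msigma (isg Q0).
have [iv2 _] := cube_sqrt_jensen Q0 v0 mv (iv Q0).
have s20 x : 0 < sigma x `^ 2^-1 by exact: powR_gt0.
have hs0 := mass_gt0 Q0 s20 is2.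
have [|||||_ +] := @cube_jensen _ _ p (fun x => (sigma x `^ 2^-1)^-1)
  (fun x => sigma x `^ 2^-1) (fun=> 1) (fun x => v x `^ 2^-1) Q p1 Q0 _ _ _ s20 _ _ is2 iv2.
- rewrite (_ : (fun x => _) = (fun x => sigma x `^ (- 2^-1))).
    exact: measurable_powR_comp.
  by apply/funext => x; rewrite powRN.
- exact: measurable_powR_comp.
- by move=> x; rewrite invr_ge0 ltW.
- by move=> x; rewrite mulVf// gt_eqF.
- move=> x; rewrite -powRN -powRrM -powRD; last by rewrite [sigma x == 0]gt_eqF// implybT.
  by rewrite -powRrM; congr (_ `^ _); field; lra.
rewrite (mass1 (ltW Q0)).
move=> h; apply: (jensen_product_ge1 p1r (volume_gt0 Q0) hs0 _ h).
by apply: Rintegral_ge0 => x _; exact: powR_ge0.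
Qed.

(** The coefficient of 1_Q in T f. *)
Definition avg_coefficient Q : R :=
  alpha Q * (mass (fun x => `|f x|) Q / volume Q) / volume Q.

Lemma avg_coefficient_ge0 Q : D Q -> 0 <= avg_coefficient Q.
Proof.
move=> DQ; have m0 := volume_gt0 (grid_side_gt0 gridD DQ).
rewrite /avg_coefficient divr_ge0 ?(ltW m0)// mulr_ge0 ?alpha0// divr_ge0 ?(ltW m0)//.
by apply: Rintegral_ge0 => x _.
Qed.

(** Duality: with u the localized sum and g = u^(p-1) v, the integral of u^p v is the
    bilinear form of f and g, while int g^p' v^(1-p') is again the integral of u^p v, so
    weighted_form_absorb applies. *)
Lemma localized_weighted_bound N Q : D Q ->
  leb.-integrable (cube_set Q)
    (EFin \o (fun x => localized_sum avg_coefficient N Q x `^ p * v x)) /\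
  mass (fun x => localized_sum avg_coefficient N Q x `^ p * v x) Q <=
  form_constant p * (A `^ Num.max 1 (p - 1)^-1 * k) `^ p *
  mass (fun x => `|f x| `^ p * v x) Q.
Proof.
move=> DQ; have p1r := p1; have p0 : 0 < p by lra.
have sub P d : D P -> D (subcube P d) by move=> DP; exact: grid_subcube.
have pos P : D P -> 0 < side P by exact: grid_side_gt0.
pose u := localized_sum avg_coefficient N Q.
have u0 x : 0 <= u x by exact: (localized_sum_ge0 hn gridD avg_coefficient_ge0).
have mu : measurable_fun setT u by exact: measurable_localized_sum.
pose B := tree_sum subcube N avg_coefficient Q.
have uB x : u x <= B by exact: (localized_sum_le hn gridD avg_coefficient_ge0).
have bounded r P : 0 <= r -> 0 < side P ->
    leb.-integrable (cube_set P) (EFin \o (fun x => u x `^ r * v x)).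
  move=> r0 P0; have mP := measurable_cube_set P.
  apply: (@le_integrable _ _ _ _ _ mP _ (EFin \o (fun x => B `^ r * v x))).
  - apply/measurable_EFinP; apply: measurable_funTS; apply: measurable_funM => //.
    exact: measurable_powR_comp.
  - move=> x _; rewrite /= lee_fin !normrM ler_wpM2r// !ger0_norm ?powR_ge0//.
    by rewrite ge0_ler_powR ?nnegrE// (le_trans (u0 x)).
  - exact: (integrableZl mP (B `^ r) (iv P0)).
split; first by apply: bounded; [exact: ltW|exact: pos].
have r0 : 0 <= p - 1 by lra.
pose g x := u x `^ (p - 1) * v x.
pose G x := u x `^ p * v x.
have ig P : 0 < side P -> leb.-integrable (cube_set P) (EFin \o g) by exact: bounded.
have iG P : 0 < side P -> leb.-integrable (cube_set P) (EFin \o G).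
  by apply: bounded; exact: ltW.
have q1 : 1 < p / (p - 1) by rewrite ltr_pdivlMr; lra.
have jg P : 0 < side P -> mass v P * (mass g P / mass v P) `^ (p / (p - 1)) <= mass G P.
  move=> P0.
  apply: (@cube_jensen _ _ (p / (p - 1)) (fun x => u x `^ (p - 1)) v g G P
    q1 P0 _ mv _ v0 _ _ (iv P0) (iG _ P0)).2 => //.
  - exact: measurable_powR_comp.
  - by move=> x; exact: powR_ge0.
  - move=> x; rewrite -powRrM (_ : (p - 1) * (p / (p - 1)) = p)//.
    by field; lra.
pose hs x := dual_density x `^ 2^-1; pose hv x := v x `^ 2^-1.
have jhs P (P0 : 0 < side P) := cube_sqrt_jensen P0 sigma0 msigma (isg P0).
have jhv P (P0 : 0 < side P) := cube_sqrt_jensen P0 v0 mv (iv P0).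
have jf P (P0 : 0 < side P) := cube_integrable_abs P0.
have nonneg h P : (forall x, 0 <= h x) -> 0 <= mass h P.
  by move=> h0; apply: Rintegral_ge0 => x _.
apply: (@weighted_form_absorb R _ _ subcube D sub p k A volume
  (mass dual_density) (mass v) (mass hs) (mass hv) (mass (fun x => `|f x|))
  (mass (fun x => `|f x| `^ p * v x)) (mass g) (mass G) alpha p1r).
- by move=> P DP; apply: volume_subcubes; exact: pos.
- by move=> P DP; apply: mass_subcubes; [exact: pos|exact/isg/pos].
- by move=> P DP; apply: mass_subcubes; [exact: pos|exact/iv/pos].
- by move=> P DP; apply: mass_subcubes; [exact: pos|exact: (jhs _ (pos _ DP)).1].
- by move=> P DP; apply: mass_subcubes; [exact: pos|exact: (jhv _ (pos _ DP)).1].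
- by move=> P DP; apply: mass_subcubes; [exact: pos|exact: (jf _ (pos _ DP)).1].
- by move=> P DP; apply: mass_subcubes; [exact: pos|exact/ifv/pos].
- by move=> P DP; apply: mass_subcubes; [exact: pos|exact/ig/pos].
- by move=> P DP; apply: mass_subcubes; [exact: pos|exact/iG/pos].
- by move=> P DP; apply: volume_gt0; exact: pos.
- by move=> P DP; apply: mass_gt0 => //; [exact: pos|exact/isg/pos].
- by move=> P DP; apply: mass_gt0 => //; [exact: pos|exact/iv/pos].
- move=> P DP; apply: mass_gt0 => //; [exact: pos|by move=> x; exact: powR_gt0|].
  exact: (jhs _ (pos _ DP)).1.
- move=> P DP; apply: mass_gt0 => //; [exact: pos|by move=> x; exact: powR_gt0|].
  exact: (jhv _ (pos _ DP)).1.
- by move=> P DP; apply: nonneg.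
- by move=> P DP; apply: nonneg => x; rewrite mulr_ge0 ?powR_ge0// ltW.
- by move=> P DP; exact: (jhs _ (pos _ DP)).2.
- by move=> P DP; exact: (jhv _ (pos _ DP)).2.
- by move=> P DP; exact: (jf _ (pos _ DP)).2.
- by move=> P DP; exact/jg/pos.
- by move=> P DP; apply: cube_duality; exact: pos.
- by move=> P DP; apply: Ap; exact: pos.
- exact: k0.
- exact: alpha0.
- exact: car.
- exact: DQ.
- by apply: nonneg => x; rewrite mulr_ge0 ?powR_ge0// ltW.
rewrite /mass (_ : G = fun x => u x * g x); last first.
  by apply/funext => x; rewrite /G /g mulrA mulr_powRB1.
rewrite (Rintegral_localized_sum hn gridD avg_coefficient_ge0 N DQ (ig _ (pos _ DQ))).
rewrite le_eqVlt; apply/orP; left; apply/eqP; congr (tree_sum _ _ _ _).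
by apply/funext => P; rewrite /avg_coefficient /mass; ring.
Qed.
End weighted_bound.

(** * Passage to the whole space *)

(** The majorant h is the increasing limit of (level_sum N)^p v; the last clause reads
    (sum_Q t_Q 1_Q)^p v <= h wherever h is finite. *)
Lemma grid_sum_majorant (R : realType) (n : nat) (hn : (0 < n)%N) (D : set (cube R n))
    (gridD : dyadic_grid D) (t : cube R n -> R) (p K : R) (v : Rn R n -> R)
    (G : Rn R n -> \bar R) :
  (forall Q, D Q -> 0 <= t Q) -> 0 < p -> 0 <= K ->
  measurable_fun setT v -> (forall x, 0 < v x) ->
  measurable_fun setT G -> (forall x, 0 <= G x)%E ->
  (forall N Q, D Q ->
    (\int[leb]_(x in cube_set Q) (localized_sum t N Q x `^ p * v x)%:E <=
     K%:E * \int[leb]_(x in cube_set Q) G x)%E) ->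
  exists h : Rn R n -> \bar R,
  [/\ measurable_fun setT h, forall x, (0 <= h x)%E,
      (\int[leb]_x h x <= K%:E * \int[leb]_x G x)%E &
      forall x (M : R), (h x <= M%:E)%E ->
        (\esum_(Q in D) (t Q * \1_(cube_set Q) x)%:E <= ((M / v x) `^ p^-1)%:E)%E].
Proof.
move=> t0 p0 K0 mv v0 mG G0 loc.
pose g N x := (level_sum D t N x `^ p * v x)%:E.
have mg N : measurable_fun setT (g N).
  apply/measurable_EFinP; apply: measurable_funM => //; apply: measurable_powR_comp.
  exact: measurable_level_sum.
have g0 N x : (0 <= g N x)%E by rewrite lee_fin mulr_ge0 ?powR_ge0// ltW.
have gnd x : {homo g^~ x : N M / (N <= M)%N >-> (N <= M)%E}.
  move=> N M NM; rewrite lee_fin ler_wpM2r ?(ltW (v0 x))//.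
  by rewrite ge0_ler_powR ?nnegrE ?(ltW p0) ?level_sum_ge0// level_sum_nondecreasing.
have gcvg x := ereal_nondecreasing_is_cvgn (gnd x).
have glim N x : (g N x <= limn (g^~ x))%E.
  rewrite (cvg_lim _ (ereal_nondecreasing_cvgn (gnd x)))//.
  by apply: ereal_sup_ubound; exists N.
exists (fun x => limn (g^~ x)); split.
- apply: (@emeasurable_fun_cvg _ _ _ _ g) => // x _; exact: gcvg.
- by move=> x; apply: le_trans (g0 0%N x) (glim 0%N x).
- rewrite monotone_convergence//.
  apply: lime_le.
    apply: ereal_nondecreasing_is_cvgn => N M NM.
    apply: ge0_le_integral => //.
    by move=> x _; exact: gnd.
  apply: nearW => N; apply: (le_integral_generation gridD (k := N%:Z)) => //.
  move=> Q gQ; have [DQ _] := gQ.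
  apply: le_trans (loc (N + N)%N Q DQ).
  rewrite le_eqVlt; apply/orP; left; apply/eqP; apply: eq_integral => x.
  rewrite inE => Qx; rewrite /g /level_sum -(tree_sum_chain hn gridD _ t gQ Qx).
  by [].
- move=> x M hM; rewrite esum_level_sum//; apply: ge_ereal_sup => _ [N _ <-].
  have := le_trans (glim N x) hM; rewrite !lee_fin => gM.
  have l0 : 0 <= level_sum D t N x by exact: level_sum_ge0.
  have -> : level_sum D t N x = (level_sum D t N x `^ p) `^ p^-1.
    by rewrite -powRrM divff ?gt_eqF// powRr1.
  have gM' : level_sum D t N x `^ p <= M / v x by rewrite ler_pdivlMr.
  rewrite ge0_ler_powR ?nnegrE ?invr_ge0 ?(ltW p0) ?powR_ge0//.
  exact: le_trans (powR_ge0 _ _) gM'.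
Qed.

Lemma rsum_le (R : realType) (I : choiceType) (S : set I) (u t : I -> R) (y : R) :
  (forall i, S i -> `|u i| <= t i) -> (\esum_(i in S) (t i)%:E <= y%:E)%E ->
  `|rsum S u| <= y.
Proof.
move=> ut ty.
have t0 i : S i -> 0 <= t i by move=> Si; exact: le_trans (ut i Si).
have part (s : I -> R) : (forall i, S i -> s i <= t i) ->
    0 <= fine (\esum_(i in S) (Num.max (s i) 0)%:E) <= y.
  move=> st; have e0 : (0 <= \esum_(i in S) (Num.max (s i) 0)%:E)%E.
    by apply: esum_ge0 => i _; rewrite lee_fin le_max lexx orbT.
  have ey : (\esum_(i in S) (Num.max (s i) 0)%:E <= y%:E)%E.
    apply: le_trans ty; apply: le_esum => i Si.
    by rewrite lee_fin ge_max st ?t0.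
  rewrite fine_ge0//= -lee_fin fineK//.
  by rewrite ge0_fin_numE// (le_lt_trans ey)// ltry.
have := part u (fun i Si => le_trans (ler_norm _) (ut i Si)).
have uN i : S i -> - u i <= t i.
  by move=> Si; rewrite (le_trans _ (ut i Si))// -normrN ler_norm.
have := part (fun i => - u i) uN.
by rewrite /rsum ler_norml; lra.
Qed.

Section positive_weight.
Context {R : realType} {n : nat}.
Variable w : {mfun Rn R n >-> R}.
Hypothesis weight_w : weight w.

(** A representative of w that is positive everywhere, so that its powers can be
    multiplied and divided pointwise. *)
Definition positive_version (x : Rn R n) : R := if 0 < w x then w x else 1.
Local Notation v := positive_version.

Lemma positive_version_gt0 x : 0 < v x.
Proof. by rewrite /positive_version; case: ifPn. Qed.

Lemma measurable_positive_version : measurable_fun setT v.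
Proof.
apply: measurable_fun_ifT => //.
by apply: measurable_fun_ltr.
Qed.

Lemma positive_version_ae : {ae leb, forall x, w x = v x}.
Proof.
have [_ w0] := weight_w.
by apply: filterS w0 => x wx; rewrite /positive_version wx.
Qed.

Lemma integrable_positive_version Q : 0 < side Q ->
  leb.-integrable (cube_set Q) (EFin \o v).
Proof.
move=> Q0; have mQ := measurable_cube_set Q.
apply: (@le_integrable _ _ _ _ _ mQ _ (EFin \o (fun x => `|w x| + 1))).
- by apply/measurable_EFinP/measurable_funTS; exact: measurable_positive_version.
- move=> x _; rewrite /= lee_fin /positive_version; case: ifPn => wx.
    by rewrite [leRHS]ger0_norm ?addr_ge0// lerDl.
  by rewrite normr1 ger0_norm ?addr_ge0// lerDr.
- have [lw _] := weight_w.
  exact: (integrableD mQ (integrable_normr (loc_integrable_cube Q lw))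
    (integrable_cst_cube 1 (ltW Q0))).
Qed.

Lemma ge0_integral_wdx (F : Rn R n -> \bar R) : measurable_fun setT F ->
  (forall x, 0 <= F x)%E ->
  (\int[wdx w]_x F x = \int[leb]_x (F x * (v x)%:E))%E.
Proof.
move=> mF F0.
rewrite (ge0_integral_density (mu := lebesgue_tuple n) (g := fun x => `|w x|))//.
  apply: ae_eq_integral => //.
  - by apply: emeasurable_funM => //; apply/measurable_EFinP; exact: measurableT_comp.
  - apply: emeasurable_funM => //; apply/measurable_EFinP.
    exact: measurable_positive_version.
  - apply: filterS positive_version_ae => x wx _.
    by rewrite wx ger0_norm// ltW// positive_version_gt0.
exact: measurableT_comp.
Qed.

Lemma avg_weight Q : 0 < side Q -> avg Q w = (mass v Q / volume Q)%:E.
Proof.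
move=> Q0; rewrite -(avgE Q0 (integrable_positive_version Q0)) /avg.
congr (_ * _)%E; apply: ae_eq_integral.
- exact: measurable_cube_set.
- by apply/measurable_EFinP/measurable_funTS.
- by apply/measurable_EFinP/measurable_funTS; exact: measurable_positive_version.
- by apply: filterS positive_version_ae => x wx _; rewrite wx.
Qed.

Variable p : R.
Hypothesis p1 : 1 < p.
Hypothesis Ap_fin : (Ap_const p w < +oo)%E.

Lemma avg_dual_weight Q :
  avg Q (dual_weight p w) = avg Q (dual_density p v).
Proof.
have p1r := p1.
have expE : 1 - conjugate_exponent p = - (p - 1)^-1.
  by rewrite /conjugate_exponent; field; apply/andP; split; lra.
congr (_ * _)%E; apply: ae_eq_integral.
- exact: measurable_cube_set.
- by apply/measurable_EFinP/measurable_funTS; exact: measurable_powR_comp.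
- apply/measurable_EFinP/measurable_funTS; apply: measurable_powR_comp.
  exact: measurable_positive_version.
- apply: filterS positive_version_ae => x wx _.
  by rewrite /dual_weight /dual_density wx expE.
Qed.

(** The average of w over Q is positive, so the A_p condition leaves no room for an
    infinite average of the dual weight. *)
Lemma integrable_dual_density Q : 0 < side Q ->
  leb.-integrable (cube_set Q) (EFin \o dual_density p v).
Proof.
move=> Q0; have p1r := p1.
apply/integrableP; split.
  apply/measurable_EFinP/measurable_funTS; apply: measurable_powR_comp.
  exact: measurable_positive_version.
have : (avg Q w * avg Q (dual_weight p w) `^ (p - 1) <= Ap_const p w)%E.
  by apply: ereal_sup_ubound; exists Q.
move=> /le_lt_trans/(_ Ap_fin); rewrite avg_weight// avg_dual_weight => fin.
have m0 := volume_gt0 Q0.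
have v0 := mass_gt0 Q0 positive_version_gt0 (integrable_positive_version Q0).
rewrite (eq_integral (EFin \o dual_density p v)); last first.
  by move=> x _; rewrite gee0_abs// lee_fin powR_ge0.
rewrite ltey; apply: contraTneq fin => intE.
rewrite /avg intE mulry gtr0_sg ?invr_gt0// mul1e /poweR.
rewrite gt_eqF ?subr_gt0// mulry gtr0_sg ?divr_gt0// mul1e.
by rewrite -leNgt.
Qed.

Lemma Ap_const_EFin : Ap_const p w = (fine (Ap_const p w))%:E.
Proof.
pose Q : cube R n := ([tuple 0 | i < n], 1).
have Q0 : 0 < side Q by rewrite /side.
rewrite fineK// fin_numElt Ap_fin andbT.
have : (avg Q w * avg Q (dual_weight p w) `^ (p - 1) <= Ap_const p w)%E.
  by apply: ereal_sup_ubound; exists Q.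
apply: lt_le_trans; rewrite avg_weight// avg_dual_weight.
by rewrite (avgE Q0 (integrable_dual_density Q0)) poweR_EFin -EFinM ltNyr.
Qed.

Lemma Ap_density Q : 0 < side Q ->
  mass v Q / volume Q * (mass (dual_density p v) Q / volume Q) `^ (p - 1) <=
  fine (Ap_const p w).
Proof.
move=> Q0.
have : (avg Q w * avg Q (dual_weight p w) `^ (p - 1) <= Ap_const p w)%E.
  by apply: ereal_sup_ubound; exists Q.
rewrite avg_weight// avg_dual_weight (avgE Q0 (integrable_dual_density Q0)).
rewrite poweR_EFin -EFinM => h.
by rewrite -lee_fin -Ap_const_EFin.
Qed.
End positive_weight.

Section paraproduct_terms.
Context {R : realType} {n : nat}.
Implicit Types (Q : cube R n) (a b f : Rn R n -> R).

(** The coefficient of 1_Q in the operator of the theorem. *)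
Definition PiPi_coefficient a b f Q : R :=
  \sum_(e : {ffun 'I_n -> bool} | e != [ffun=> true])
    pairing a (haar Q e) * pairing b (haar Q e) * fine (avg Q f) / volume Q.

Lemma PiPi_termE a b f x Q :
  PiPi_term a b f x Q = PiPi_coefficient a b f Q * \1_(cube_set Q) x.
Proof.
rewrite /PiPi_term /PiPi_coefficient mulr_suml; apply: eq_bigr => e _.
by rewrite mulrA -!mulrA [X in _ * (_ * (_ * X))]mulrC.
Qed.

Lemma PiPi_coefficient_le a b f Q : 0 < side Q ->
  leb.-integrable (cube_set Q) (EFin \o f) ->
  `|PiPi_coefficient a b f Q| <= avg_coefficient f (haar_product a b) Q.
Proof.
move=> Q0 if_; have m0 := volume_gt0 Q0.
rewrite /PiPi_coefficient /avg_coefficient /haar_product.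
rewrite !mulr_suml; apply: (le_trans (ler_norm_sum _ _ _)); apply: ler_sum => e _.
rewrite fine_avg// !normrM [`|(volume Q)^-1|]ger0_norm ?invr_ge0 ?(ltW m0)//.
rewrite ler_wpM2r ?invr_ge0 ?(ltW m0)// ler_wpM2l ?mulr_ge0//.
rewrite ler_wpM2r ?invr_ge0 ?(ltW m0)//.
by apply: le_normr_Rintegral => //; exact: measurable_cube_set.
Qed.
End paraproduct_terms.

Lemma measurable_PiPi (R : realType) (n : nat) (D : set (cube R n))
    (a b f : Rn R n -> R) : (0 < n)%N -> dyadic_grid D ->
  measurable_fun setT (PiPi D a b f).
Proof.
move=> hn gridD.
have part (c : cube R n -> R) : measurable_fun setT (fun x : Rn R n =>
    fine (\esum_(Q in D) (Num.max (c Q * \1_(cube_set Q) x) 0)%:E)).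
  apply: (measurableT_comp (fine_measurable measurableT)).
  rewrite (_ : (fun x => _) = (fun x : Rn R n =>
     \esum_(Q in D) (Num.max (c Q) 0 * \1_(cube_set Q) x)%:E)).
    by apply: measurable_esum_grid => // Q _; rewrite le_max lexx orbT.
  apply/funext => x; apply: eq_esum => Q _; congr EFin.
  by rewrite indicE; case: (_ \in _); rewrite ?mulr1// !mulr0 maxxx.
rewrite (_ : PiPi D a b f = fun x =>
  fine (\esum_(Q in D) (Num.max (PiPi_coefficient a b f Q * \1_(cube_set Q) x) 0)%:E) -
  fine (\esum_(Q in D) (Num.max (- PiPi_coefficient a b f Q * \1_(cube_set Q) x) 0)%:E)).
  by apply: measurable_funB; exact: part.
apply/funext => x; rewrite /PiPi /rsum; congr (fine _ - fine _).
  by apply: eq_esum => Q _; rewrite PiPi_termE.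
by apply: eq_esum => Q _; rewrite PiPi_termE mulNr.
Qed.

Section weighted_estimate.
Context {R : realType} {n : nat}.
Hypothesis hn : (0 < n)%N.
Variables (p : R) (D : set (cube R n)) (w : {mfun Rn R n >-> R}) (a b : Rn R n -> R).
Hypothesis p1 : 1 < p.
Hypothesis gridD : dyadic_grid D.
Hypothesis weight_w : weight w.
Hypothesis Ap_fin : (Ap_const p w < +oo)%E.
Hypothesis bmo_a : bmo D a.
Hypothesis bmo_b : bmo D b.

Let k := carleson_constant R n * (fine (bmo_norm D a) * fine (bmo_norm D b)).
Let W := fine (Ap_const p w) `^ Num.max 1 (p - 1)^-1.

Let k0 : 0 <= k.
Proof.
by rewrite mulr_ge0 ?carleson_constant_ge0// mulr_ge0// fine_ge0// (bmo_norm_ge0 gridD).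
Qed.

Lemma PiPi_weighted_majorant (f : Rn R n -> R) : f \in Lfun (wdx w) p%:E ->
  {ae leb, forall x, summable D (fun Q => (PiPi_term a b f x Q)%:E)} /\
  (\int[wdx w]_x (`|PiPi D a b f x| `^ p)%:E <=
   (form_constant p * (W * k) `^ p)%:E * \int[wdx w]_x (`|f x| `^ p)%:E)%E.
Proof.
move=> fL; have p1r := p1; have p0 : 0 < p by lra.
have mf : measurable_fun setT f by move: fL; rewrite inE => /andP[]; rewrite inE.
pose v := positive_version w.
have v0 := positive_version_gt0 w : forall x, 0 < v x.
have mv := measurable_positive_version w : measurable_fun setT v.
have iv Q (Q0 : 0 < side Q) := integrable_positive_version weight_w Q0.
have isg Q (Q0 : 0 < side Q) := integrable_dual_density weight_w p1 Ap_fin Q0.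
have mfp : measurable_fun setT (fun x => (`|f x| `^ p)%:E).
  by apply/measurable_EFinP; apply: measurable_powR_comp; exact: measurableT_comp.
have fp0 x : (0 <= (`|f x| `^ p)%:E)%E by rewrite lee_fin powR_ge0.
pose G x := (`|f x| `^ p * v x)%:E.
have G0 x : (0 <= G x)%E by rewrite lee_fin mulr_ge0 ?powR_ge0// ltW.
have mG : measurable_fun setT G.
  apply/measurable_EFinP; apply: measurable_funM => //.
  by apply: measurable_powR_comp; exact: measurableT_comp.
have intG : (\int[wdx w]_x (`|f x| `^ p)%:E = \int[leb]_x G x)%E.
  by rewrite (ge0_integral_wdx weight_w mfp fp0).
have finG : (\int[leb]_x G x < +oo)%E.
  by rewrite -intG; apply: (integrable_lty measurableT); apply: Lfun_integrable => //; exact: ltW.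
have iGT : leb.-integrable setT G.
  apply/integrableP; split => //.
  by under eq_integral do rewrite gee0_abs//.
have iG Q : 0 < side Q -> leb.-integrable (cube_set Q) G.
  by move=> _; apply: integrableS iGT => //; exact: measurable_cube_set.
have if_ Q : 0 < side Q -> leb.-integrable (cube_set Q) (EFin \o f).
  move=> Q0; have mQ := measurable_cube_set Q.
  have [h _] := cube_integrable_abs p1 v0 mv isg mf iG Q0.
  apply: (le_integrable mQ _ _ h); first exact/measurable_EFinP/measurable_funTS.
  by move=> x _; rewrite /= lee_fin normr_id.
pose t := avg_coefficient f (haar_product a b).
have alpha0 Q : D Q -> 0 <= haar_product a b Q by move=> _; exact: haar_product_ge0.
have t0 Q : D Q -> 0 <= t Q by exact: (avg_coefficient_ge0 gridD).
have ct Q : D Q -> `|PiPi_coefficient a b f Q| <= t Q.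
  move=> DQ; have Q0 := grid_side_gt0 gridD DQ.
  by apply: PiPi_coefficient_le => //; exact: if_.
have K0 : 0 <= form_constant p * (W * k) `^ p.
  by rewrite mulr_ge0 ?powR_ge0// form_constant_ge0.
have car N Q : D Q -> tree_sum subcube N (haar_product a b) Q <= k * volume Q.
  by move=> DQ; rewrite /k; exact: (haar_product_carleson hn gridD).
have Apv Q (Q0 : 0 < side Q) := Ap_density weight_w p1 Ap_fin Q0.
have [|h [mh h0 hint hM]] := grid_sum_majorant hn gridD t0 p0 K0 mv v0 mG G0.
  move=> N Q DQ; have Q0 := grid_side_gt0 gridD DQ; have mQ := measurable_cube_set Q.
  have [iu bound] :=
    localized_weighted_bound hn gridD p1 v0 mv iv isg Apv mf iG alpha0 k0 car N DQ.
  have fin1 := integrable_fin_num mQ iu; have fin2 := integrable_fin_num mQ (iG Q Q0).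
  by rewrite -(fineK fin1) -(fineK fin2) -EFinM lee_fin.
have termle x Q : D Q -> `|PiPi_term a b f x Q| <= t Q * \1_(cube_set Q) x.
  move=> DQ; rewrite PiPi_termE normrM [`|\1_(cube_set Q) x|]ger0_norm//.
  by rewrite ler_wpM2r// ct.
split.
  have ih : leb.-integrable setT h.
    apply/integrableP; split => //.
    under eq_integral do rewrite gee0_abs//.
    apply: (le_lt_trans hint); rewrite lte_mul_pinfty ?lee_fin//.
  apply: filterS (integrable_ae measurableT ih) => x /(_ I) hx.
  have := hM x (fine (h x)); rewrite fineK// lexx => /(_ isT) hy.
  apply: le_lt_trans (ltry ((fine (h x) / v x) `^ p^-1)).
  apply: le_trans hy; apply: le_esum => Q DQ.
  by rewrite lee_fin; exact: termle.
rewrite intG (ge0_integral_wdx weight_w); last 2 first.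
- apply/measurable_EFinP; apply: measurable_powR_comp; apply: measurableT_comp => //.
  exact: measurable_PiPi.
- by move=> x; rewrite lee_fin powR_ge0.
apply: le_trans hint; apply: ge0_le_integral => //.
- by move=> x _; rewrite mule_ge0// lee_fin ?powR_ge0// ltW.
- apply: emeasurable_funM; last exact/measurable_EFinP.
  apply/measurable_EFinP; apply: measurable_powR_comp; apply: measurableT_comp => //.
  exact: measurable_PiPi.
move=> x _; have := h0 x; case E : (h x) => [M| |]; rewrite ?leey//.
rewrite lee_fin => M0; have := hM x M; rewrite E lexx => /(_ isT) hy.
have := rsum_le (fun Q => termle x Q) hy; rewrite -/(PiPi D a b f x) => hP.
rewrite -EFinM lee_fin -ler_pdivlMr//.
have Mv : 0 <= M / v x by rewrite divr_ge0// ltW.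
rewrite (_ : _ / _ = ((M / v x) `^ p^-1) `^ p); last first.
  by rewrite -powRrM mulVf ?gt_eqF// powRr1.
by rewrite ge0_ler_powR ?nnegrE ?(ltW p0) ?powR_ge0.
Qed.
End weighted_estimate.

Lemma EFin_regroup (R : realType) (r s x y z : R) :
  ((r * s)%:E * x%:E * y%:E * z%:E = (r * (z * (s * (x * y))))%:E)%E.
Proof. by rewrite -!EFinM; congr EFin; ring. Qed.

Theorem mainTheorem7 (R : realType) (n : nat) (hn : (0 < n)%N) (p : R)
    (hp : 1 < p) :
  exists C : R,
    forall (D : set (cube R n)) (w : {mfun Rn R n >-> R}) (a b : Rn R n -> R),
      dyadic_grid D ->
      weight w -> (Ap_const p w < +oo)%E ->
      bmo D a -> bmo D b ->
      (forall f : Rn R n -> R, f \in Lfun (wdx w) p%:E ->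
        {ae leb, forall x, summable D (fun Q => (PiPi_term a b f x Q)%:E)}) /\
      (opnorm (wdx w) p (PiPi D a b) <=
        C%:E * bmo_norm D a * bmo_norm D b *
        (Ap_const p w `^ Num.max 1%R (p - 1)^-1%R))%E.
Proof.
have p0 : 0 < p by lra.
pose c : R := form_constant p `^ p^-1 * carleson_constant R n.
exists c => D w a b gridD weight_w Ap_fin bmo_a bmo_b; split=> [f fL|].
  exact: (PiPi_weighted_majorant hn hp gridD weight_w Ap_fin bmo_a bmo_b fL).1.
set W := fine (Ap_const p w) `^ Num.max 1 (p - 1)^-1.
set k := carleson_constant R n * (fine (bmo_norm D a) * fine (bmo_norm D b)).
have k0 : 0 <= k.
  by rewrite mulr_ge0 ?carleson_constant_ge0// mulr_ge0// fine_ge0// (bmo_norm_ge0 gridD).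
have W0 : 0 <= W by exact: powR_ge0.
have c1 := form_constant_ge0 hp.
pose M := form_constant p `^ p^-1 * (W * k).
have -> : (c%:E * bmo_norm D a * bmo_norm D b *
    Ap_const p w `^ Num.max 1%R (p - 1)^-1%R)%E = M%:E.
  rewrite (Ap_const_EFin weight_w hp Ap_fin) poweR_EFin.
  rewrite -(bmo_norm_fin gridD bmo_a) -(bmo_norm_fin gridD bmo_b).
  exact: EFin_regroup.
have M0 : 0 <= M by rewrite mulr_ge0 ?powR_ge0// mulr_ge0.
have Mp : form_constant p * (W * k) `^ p = M `^ p.
  rewrite (powRM p (powR_ge0 _ _) (mulr_ge0 W0 k0)) -powRrM mulVf ?gt_eqF//.
  by rewrite (powRr1 c1).
apply: ereal_inf_lbound; exists M => //; split => // f fL.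
have [_ bound] := PiPi_weighted_majorant hn hp gridD weight_w Ap_fin bmo_a bmo_b fL.
have NE (g : Rn R n -> R) :
    ('N[wdx w]_p%:E[EFin \o g] = (\int[wdx w]_x (`|g x| `^ p)%:E) `^ p^-1)%E.
  by rewrite unlock.
have int0 (g : Rn R n -> R) : (0 <= \int[wdx w]_x (`|g x| `^ p)%:E)%E.
  by apply: integral_ge0 => x _; rewrite lee_fin powR_ge0.
have Nle : ('N[wdx w]_p%:E[EFin \o PiPi D a b f] <= M%:E * 'N[wdx w]_p%:E[EFin \o f])%E.
  rewrite !NE.
  have -> : (M%:E = (M `^ p)%:E `^ p^-1)%E.
    by rewrite poweR_EFin -powRrM divff ?gt_eqF// powRr1.
  rewrite -poweRM ?lee_fin ?powR_ge0//.
  apply: gt0_ler_poweR; rewrite ?invr_ge0 ?(ltW p0) ?in_itv/= ?leey ?andbT//.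
    by rewrite mule_ge0// lee_fin powR_ge0.
  by rewrite -Mp.
split=> //; rewrite inE; apply/andP; split; first by rewrite inE; exact: measurable_PiPi.
rewrite inE /= /finite_norm; apply: (le_lt_trans Nle).
have fN : ('N[wdx w]_p%:E[EFin \o f] < +oo)%E.
  by move: fL; rewrite inE => /andP[_]; rewrite inE.
rewrite lte_mul_pinfty// ?lee_fin//.
Qed.
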